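(* Assume that $K$ is simple and $\operatorname{Ad}(K)|_{\mathfrak a}$ is irreducible. Let $T\in\mathcal M_K$, i.e., $$T=T_{\mathfrak a}Q|_{\mathfrak a}+T_1Q|_{\mathfrak k_1}$$ with constants $T_{\mathfrak a},T_1>0$. Then a metric $g\in\mathcal M_K$ satisfying $\operatorname{Ric}_g=cT$ for some $c>0$ exists if and only if $$(2d_1(1-\kappa_1)+n)T_1>nT_{\mathfrak a}\kappa_1.$$ When it exists, this metric $g$ is unique up to scaling.
   Context: $G$ is a compact simple Lie group and $K<G$ is a non-trivial compact Lie subgroup, $K\neq G$, with Lie algebras $\mathfrak g$ and $\mathfrak k$. $Q$ is the negative of the Killing form of $\mathfrak g$ (an inner product). Since $K$ is simple, $\mathfrak k=\mathfrak k_1$ is a simple Lie algebra and $\mathfrak g=\mathfrak a\oplus\mathfrak k_1$, where $\mathfrak a=\mathfrak k^\perp$ is the $Q$-orthogonal complement of $\mathfrak k$. Put $n=\dim\mathfrak a$, $d_1=\dim\mathfrak k_1$. The constant $\kappa_1\in(0,1)$ is defined by $B_1=-\kappa_1Q|_{\mathfrak k_1}$, where $B_1$ is the Killing form of $\mathfrak k_1$. Left-invariant metrics (and tensor fields) on $G$ are identified with the inner products (bilinear forms) they induce on $\mathfrak g$. In this situation, $\mathcal M_K$ is the set of left-invariant metrics on $G$ of the form $\alpha Q|_{\mathfrak a}+\alpha_1Q|_{\mathfrak k_1}$ with positive constants $\alpha,\alpha_1$. $\operatorname{Ric}_g$ is the Ricci curvature of $g$ as a $(0,2)$-tensor. *)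

(* Defs.v *)
From HB Require Import structures.
From mathcomp Require Import all_boot all_order all_algebra.
From mathcomp Require Import all_classical all_reals all_analysis.
Set Implicit Arguments.
Unset Strict Implicit.
Unset Printing Implicit Defensive.
Import Order.TTheory GRing.Theory Num.Theory.
Import numFieldNormedType.Exports.
Local Open Scope classical_set_scope.
Local Open Scope ring_scope.

(** * Lie groups *)

(** [U] is meant to be open.  In finite dimension this is the usual class C^k:
    the differential [v |-> 'D_v f] is C^(k-1) iff each ['D_v f] is. *)
Fixpoint Ck (R : realType) (V W : normedModType R) (k : nat) (U : set V)
    (f : V -> W) : Prop :=
  match k with
  | 0%N => {in U, continuous f}
  | k'.+1 => {in U, forall x, differentiable f x} /\
             forall v : V, Ck k' U ('D_v f)
  end.

Definition smooth (R : realType) (V W : normedModType R) (U : set V)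
    (f : V -> W) : Prop := forall k, Ck k U f.

(** The values of [chart_fun] outside [chart_dom], and of [chart_inv] outside
    the image of [chart_dom], are irrelevant. *)
Record chart (R : realType) (T : topologicalType) (d : nat) := Chart {
  chart_dom : set T ;
  chart_fun :> T -> 'rV[R]_d ;
  chart_inv : 'rV[R]_d -> T ;
  chart_dom_open : open chart_dom ;
  chart_img_open : open (chart_fun @` chart_dom) ;
  chart_funK : {in chart_dom, cancel chart_fun chart_inv} ;
  chart_fun_continuous : {in chart_dom, continuous chart_fun} ;
  chart_inv_continuous : {in chart_fun @` chart_dom, continuous chart_inv}
}.

(** The smooth structure is given by the atlas [{chart_at x | x : G}], where
    [chart_at x] is a chart around [x]. *)
HB.mixin Record isLieGroup (R : realType) (G : Type)
    of Group G & Topological G := {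
  lie_dim : nat ;
  chart_at : G -> chart R G lie_dim ;
  chart_at_dom : forall x, chart_dom (chart_at x) x ;
  lie_hausdorff : hausdorff_space G ;
  lie_second_countable : @second_countable G ;
  chart_compat : forall x y,
    smooth (chart_at x @` (chart_dom (chart_at x) `&` chart_dom (chart_at y)))
           (chart_at y \o chart_inv (chart_at x)) ;
  lie_mul_continuous : continuous (fun p : G * G => (p.1 * p.2)%g) ;
  lie_mul_smooth : forall x y z,
    smooth ((fun p : G * G => (chart_at x p.1, chart_at y p.2)) @`
              [set p | [/\ chart_dom (chart_at x) p.1,
                           chart_dom (chart_at y) p.2 &
                           chart_dom (chart_at z) (p.1 * p.2)%g]])
           (fun q => chart_at z (chart_inv (chart_at x) q.1 *
                                 chart_inv (chart_at y) q.2)%g) ;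
  lie_inv_continuous : continuous (fun a : G => (a^-1)%g) ;
  lie_inv_smooth : forall x y,
    smooth (chart_at x @` [set a | chart_dom (chart_at x) a /\
                                   chart_dom (chart_at y) (a^-1)%g])
           (fun u => chart_at y ((chart_inv (chart_at x) u)^-1)%g)
}.

#[short(type="lieGroupType")]
HB.structure Definition LieGroup (R : realType) :=
  { G of isLieGroup R G & Group G & Topological G }.

(** The tangent space of [G] at the identity, in the coordinates of [chart1]
    below. *)
Notation lie_algebra R G := 'rV[R]_(@lie_dim R G).

Section LieAlgebra.
Variables (R : realType) (G : lieGroupType R).
Local Notation lg := (lie_algebra R G).

Definition chart1 : chart R G (@lie_dim R G) := chart_at (1%g : G).

(** The left-invariant vector field with value [X] at the identity, read in
    [chart1]. *)
Definition left_field X : lg -> lg := fun u =>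
  'D_X (fun w => chart1 (chart_inv chart1 u * chart_inv chart1 w)%g)
       (chart1 1%g).

(** The coordinate expression [D_X Y - D_Y X] of the bracket of the
    left-invariant fields, at the identity. *)
Definition bracket X Y : lg :=
  'D_X (left_field Y) (chart1 1%g) - 'D_Y (left_field X) (chart1 1%g).

(** The differential at the identity of [x |-> h x h^-1]. *)
Definition Ad (h : G) X : lg :=
  'D_X (fun u => chart1 (h * chart_inv chart1 u * h^-1)%g) (chart1 1%g).

(** No submanifold condition is needed: by the closed subgroup theorem, a
    compact subgroup is the same thing as a compact (embedded) Lie subgroup. *)
Definition compact_subgroup (K : set G) : Prop :=
  [/\ compact K, K 1%g, (forall x y, K x -> K y -> K (x * y)%g) &
      forall x, K x -> K (x^-1)%g].

(** [V] is the set of initial velocities of one-parameter subgroups of [G]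
    that stay in [K], i.e. [{X | exp (t X) \in K for all t}]. *)
Definition is_lie_algebra_of (K : set G) (V : {vspace lg}) : Prop :=
  forall X, X \in V <->
    exists gamma : R -> G,
      [/\ continuous gamma,
          (forall s t, gamma (s + t) = (gamma s * gamma t)%g),
          (forall t, K (gamma t)) &
          is_derive (0 : R) (1 : R) (fun t => chart1 (gamma t)) X].

Definition Ad_irreducible (K : set G) (V : {vspace lg}) : Prop :=
  V <> 0%VS /\
  forall W : {vspace lg}, (W <= V)%VS ->
    (forall h X, K h -> X \in W -> Ad h X \in W) -> W = 0%VS \/ W = V.

Definition simple_lie (V : {vspace lg}) : Prop :=
  (exists X Y, [/\ X \in V, Y \in V & bracket X Y != 0]) /\
  forall I : {vspace lg}, (I <= V)%VS ->
    (forall X Y, X \in V -> Y \in I -> bracket X Y \in I) -> I = 0%VS \/ I = V.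

(** Trace of (the restriction of) a linear map preserving the subspace [V]. *)
Definition trace_on (V : {vspace lg}) (f : lg -> lg) : R :=
  \sum_(i < \dim V) coord (vbasis V) i (f (vbasis V)`_i).

Definition killing (V : {vspace lg}) X Y : R :=
  trace_on V (fun Z => bracket X (bracket Y Z)).

Definition Q X Y : R := - killing fullv X Y.

Definition is_orthogonal_complement (k a : {vspace lg}) : Prop :=
  forall X, X \in a <-> forall Y, Y \in k -> Q X Y = 0.

(** * Left-invariant metrics and their Ricci curvature

    A left-invariant tensor field is identified with its value at the
    identity. *)

Definition lie_form := lg -> lg -> R.

(** The Levi-Civita connection on left-invariant fields: [nabla g X Y] is the
    vector determined by the Koszul formula, whose derivative terms vanish
    because [g] is constant on left-invariant fields. *)
Definition nabla (g : lie_form) X Y : lg :=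
  get [set Z : lg | forall W : lg,
    2 * g Z W = g (bracket X Y) W - g (bracket Y W) X + g (bracket W X) Y].

Definition curvature (g : lie_form) X Y (Z : lg) : lg :=
  nabla g X (nabla g Y Z) - nabla g Y (nabla g X Z) - nabla g (bracket X Y) Z.

Definition Ric (g : lie_form) : lie_form := fun Y Z =>
  trace_on fullv (fun X => curvature g X Y Z).

(** [alpha Q|_a + alpha1 Q|_k] for [lg = a (+) k]; [daddv_pi U V] is the
    projection onto [U] along [V]. *)
Definition split_form (a k : {vspace lg}) (alpha alpha1 : R) : lie_form :=
  fun X Y => alpha * Q (daddv_pi a k X) (daddv_pi a k Y) +
             alpha1 * Q (daddv_pi k a X) (daddv_pi k a Y).

Definition M_K (a k : {vspace lg}) (g : lie_form) : Prop :=
  exists alpha alpha1 : R,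
    [/\ 0 < alpha, 0 < alpha1 & g = split_form a k alpha alpha1].

End LieAlgebra.

(* Main.v *)
Require Import Defs.
From mathcomp Require Import all_boot all_order all_algebra.
From mathcomp Require Import all_classical all_reals all_analysis.
From HB Require Import structures.
From mathcomp Require Import ring lra.
Import Order.TTheory GRing.Theory Num.Theory.
Import numFieldNormedType.Exports.
Local Open Scope classical_set_scope.
Local Open Scope ring_scope.

Set Implicit Arguments.
Unset Strict Implicit.
Unset Printing Implicit Defensive.

(** Let [lg] be the Lie algebra of [G], and [Q] minus its Killing form.  Write a
    metric of [M_K] as [alpha Q|a + alpha1 Q|k] and put [t = alpha1 / alpha].
    Its Levi-Civita connection differs from [1/2 [X, Y]] only by a multiple
    [(1 - t) / 2] of the mixed brackets (lemma [koszul]), and its Ricci tensor is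
    again diagonal (lemma [ricciE]):
      Ric|a = (1/4 + zeta (1 - t) / 2) Q    and
      Ric|k = 1/4 (kappa1 + t^2 (1 - kappa1)) Q.
    Here [zeta] is the scalar by which the Casimir operator of [k] acts on [a]:
    it is a scalar because [Ad(K)] is irreducible on [a] ([casimir_scalar]), and
    taking traces gives [zeta n = d1 (1 - kappa1)] ([casimir_trace]).  Eliminating
    [c] from Ric = c T leaves a quadratic equation
      Ta (1 - kappa1) t^2 + 2 zeta T1 t = (2 zeta + 1) T1 - Ta kappa1
    whose left-hand side increases strictly from 0 to infinity on [t >= 0], because
    [0 <= kappa1 < 1] and [zeta >= 0].  So a positive root exists if and only if the
    right-hand side is positive, and it is unique ([ricci_eqs_exists],
    [ricci_eqs_unique]).

    The facts about Lie groups that this uses are derived from the definition of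
    the bracket in a chart.
    - [Ad] is a representation, and its differential at the identity is the
      bracket ([derive_Ad]): this follows from the identity
      (x y x^-1) x = x y read in the chart, and from the equality of the mixed
      second derivatives of the multiplication ([derive_comm]).  Bilinearity, the
      Jacobi identity, the invariance of the bracket under [Ad], and the stability
      of the Lie algebra of [K] under brackets are obtained by differentiating
      identities between values of [Ad].
    - [Q] is positive definite.  Since [G] is compact, the matrices of [Ad] are
      bounded, and a bounded group of matrices preserves an inner product
      ([invariant_form_exists]); every [ad X] is skew for it, hence
      [Q X X] is the sum of the squared norms of the columns of [ad X], and it
      vanishes only on the centre, which is trivial because [lg] is simple
      ([kform_ip], [simple_center0]). *)

(** * Second derivatives *)

Lemma near_eq_differentiable (R : numFieldType) (V W : normedModType R)
    (f g : V -> W) (x : V) :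
  (\forall y \near x, f y = g y) -> differentiable f x -> differentiable g x.
Proof.
move=> fg df.
have [cdf fE] := (diff_locallyP x f).1 df.
have fgx := nbhs_singleton fg.
have fg0 : \forall y \near (0 : V), f (y + x) = g (y + x).
  by move: fg; rewrite (near_shift 0); apply: filterS => y /=; rewrite subr0.
have gE : g \o shift x = cst (g x) + 'd f x +o_ 0 id.
  apply/eqaddoP => e e0; have /eqaddoP /(_ e e0) := fE.
  apply: filter_app; move: fg0; apply: filterS => y fgy.
  have -> : (f \o shift x - (cst (f x) + 'd f x)) y =
            (g \o shift x - (cst (g x) + 'd f x)) y.
    by rewrite !fctE /= fgy fgx.
  by [].
by apply/diff_locallyP; rewrite (@diff_unique _ _ _ g ('d f x) x).
Qed.

Lemma is_derive_line (R : numFieldType) (V W : normedModType R)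
    (f : V -> W) (x v : V) (s : R) :
  derivable f (x + s *: v) v ->
  is_derive s 1 (fun t => f (x + t *: v)) ('D_v f (x + s *: v)).
Proof.
have E : (fun h : R => h^-1 *: (((fun t => f (x + t *: v)) \o shift s) (h *: 1)
            - f (x + s *: v))) =
         (fun h => h^-1 *: ((f \o shift (x + s *: v)) (h *: v) - f (x + s *: v))).
  apply/funext => h /=; congr (_ *: (f _ - _)).
  by rewrite [h%:A]mulr1 scalerDl addrCA.
move=> df; split; rewrite /derivable /derive E //.
Qed.

Lemma derive_mx_coord (R : realFieldType) (V : normedModType R) m n
    (M : V -> 'M[R]_(m, n)) (t v : V) i j : derivable M t v ->
  'D_v M t i j = 'D_v (fun x => M x i j) t.
Proof. by move=> Mv; rewrite derive_mx// mxE. Qed.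

Lemma derive_pair1 (R : numFieldType) (U V W : normedModType R)
    (f : U * V -> W) (p v : U) (q : V) :
  'D_v (fun x => f (x, q)) p = 'D_(v, 0) f (p, q).
Proof.
rewrite /derive.
suff -> : (fun h : R => h^-1 *: (((fun x => f (x, q)) \o shift p) (h *: v) - f (p, q)))
  = (fun h => h^-1 *: ((f \o shift (p, q)) (h *: (v, 0)) - f (p, q))) by [].
apply/funext => h /=; congr (_ *: (f _ - _)).
have -> : h *: (v, 0) + (p, q) = (h *: v + p, h *: 0 + q) :> U * V by [].
by rewrite scaler0 add0r.
Qed.

Lemma derive_pair2 (R : numFieldType) (U V W : normedModType R)
    (f : U * V -> W) (p : U) (q v : V) :
  'D_v (fun x => f (p, x)) q = 'D_(0, v) f (p, q).
Proof.
rewrite /derive.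
suff -> : (fun h : R => h^-1 *: (((fun x => f (p, x)) \o shift q) (h *: v) - f (p, q)))
  = (fun h => h^-1 *: ((f \o shift (p, q)) (h *: (0, v)) - f (p, q))) by [].
apply/funext => h /=; congr (_ *: (f _ - _)).
have -> : h *: (0, v) + (p, q) = (h *: 0 + p, h *: v + q) :> U * V by [].
by rewrite scaler0 add0r.
Qed.

(* Unification may otherwise unfold directional derivatives into limits. *)
#[local] Opaque derive derivable.

Section symmetry.
Context {R : realType} {V : normedModType R}.
Implicit Types (f : V -> R) (p v w : V).

(** The second difference of [f] on the parallelogram spanned by [s v] and [s w]
    is a value of the mixed derivative: the mean value theorem applied twice. *)
Lemma mixed_difference f p v w (s : R) : 0 < s ->
  (forall a b : R, 0 <= a <= s -> 0 <= b <= s -> derivable f (p + a *: v + b *: w) v) ->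
  (forall a b : R, 0 <= a <= s -> 0 <= b <= s ->
     derivable ('D_v f) (p + a *: v + b *: w) w) ->
  exists a b : R, [/\ 0 <= a <= s, 0 <= b <= s &
    f (p + s *: v + s *: w) - f (p + s *: v) - (f (p + s *: w) - f p)
      = 'D_w ('D_v f) (p + a *: v + b *: w) * (s * s)].
Proof.
move=> s0 df ddf.
have s0s : 0 <= s <= s by rewrite lexx ltW.
have s00 : (0 : R) <= 0 <= s by rewrite lexx ltW.
pose h t := f (p + s *: w + t *: v) - f (p + t *: v).
have dh t : 0 <= t <= s -> is_derive t 1 h
    ('D_v f (p + t *: v + s *: w) - 'D_v f (p + t *: v)).
  move=> ts; apply: is_deriveB.
    rewrite -[p + t *: v + _]addrAC; apply: is_derive_line.
    by rewrite addrAC; exact: df.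
  by apply: is_derive_line; have := df t 0 ts s00; rewrite scale0r addr0.
have [|||a as_ ha] := @MVT_segment R h
    (fun t => 'D_v f (p + t *: v + s *: w) - 'D_v f (p + t *: v)) 0 s.
- exact: ltW.
- by move=> x xs; apply: dh; rewrite !ltW ?(itvP xs).
- apply: derivable_within_continuous => x xs.
  by have [] := dh x _; rewrite ?(itvP xs).
have {}as_ : 0 <= a <= s by rewrite !(itvP as_).
pose g t := 'D_v f (p + a *: v + t *: w).
have dg t : 0 <= t <= s -> is_derive t 1 g ('D_w ('D_v f) (p + a *: v + t *: w)).
  by move=> ts; apply: is_derive_line; exact: ddf.
have [|||b bs hb] := @MVT_segment R g
    (fun t => 'D_w ('D_v f) (p + a *: v + t *: w)) 0 s.
- exact: ltW.
- by move=> x xs; apply: dg; rewrite !ltW ?(itvP xs).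
- apply: derivable_within_continuous => x xs.
  by have [] := dg x _; rewrite ?(itvP xs).
exists a, b; split => //.
move: ha; rewrite /h scale0r !addr0 subr0 => E.
move: hb; rewrite /g scale0r addr0 subr0 => E'.
rewrite mulrA -E' -E.
by rewrite [p + s *: v + s *: w]addrAC; ring.
Qed.

(** Two continuous functions agree at [p] as soon as, in every neighbourhood of
    [p], some value of the one is a value of the other. *)
Lemma continuous_eq_near (f g : V -> R) p :
  {for p, continuous f} -> {for p, continuous g} ->
  (forall A : set V, nbhs p A -> exists x y, [/\ A x, A y & f x = g y]) ->
  f p = g p.
Proof.
move=> cf cg fg; apply/eqP/negPn/negP; rewrite -subr_eq0 -normr_gt0 => d0.
have e0 : 0 < `|f p - g p| / 2 by rewrite divr_gt0.
move/cvgrPdist_lt: cf => /(_ _ e0) b1.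
move/cvgrPdist_lt: cg => /(_ _ e0) b2.
have [x [y [[x1 _] [_ y2] E]]] := fg _ (filterI b1 b2).
suff: `|f p - g p| < `|f p - g p| by rewrite ltxx.
rewrite [ltRHS]splitr; apply: le_lt_trans (ltrD x1 y2).
by rewrite E -[in leRHS](distrC _ (g p)) -[f p - g p](subrKA (g y)) ler_normD.
Qed.

(** Equality of mixed directional derivatives: both are limits of the same second
    differences. *)
Lemma derive_comm_scalar f p v w :
  (\forall x \near p, derivable f x v) ->
  (\forall x \near p, derivable f x w) ->
  (\forall x \near p, derivable ('D_v f) x w) ->
  (\forall x \near p, derivable ('D_w f) x v) ->
  {for p, continuous ('D_w ('D_v f))} ->
  {for p, continuous ('D_v ('D_w f))} ->
  'D_w ('D_v f) p = 'D_v ('D_w f) p.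
Proof.
move=> d1 d2 d3 d4 c1 c2; apply: (@continuous_eq_near ('D_w ('D_v f)) ('D_v ('D_w f)) p c1 c2) => A Ap.
have d12 : \forall x \near p, derivable f x v /\ derivable f x w 
  by apply: filterS2 d1 d2 => x; split.
have d34 : \forall x \near p, derivable ('D_v f) x w /\ derivable ('D_w f) x v 
  by apply: filterS2 d3 d4 => x; split.
have [r r0 Hr] := (nbhs_ballP p _).1 (@filterI _ (nbhs p) _ _ _ (@filterI _ (nbhs p) _ _ _ d12 d34) Ap).
(* the parallelogram with sides [s v] and [s w] stays in the ball of radius [r] *)
pose M := `|v| + `|w| + 1.
have M0 : 0 < M by rewrite /M ltr_wpDl ?addr_ge0.
pose s := r / (M + M).
have s0 : 0 < s by rewrite divr_gt0 // addr_gt0.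
have inball a b : 0 <= a <= s -> 0 <= b <= s -> ball p r (p + a *: v + b *: w).
  move=> /andP[a0 as_] /andP[b0 bs].
  rewrite -ball_normE /= -addrA opprD addrA subrr add0r normrN.
  rewrite (le_lt_trans (ler_normD _ _)) // !normrZ !ger0_norm //.
  apply: (@le_lt_trans _ _ (s * M)).
    rewrite /M mulrDr mulr1 mulrDr -addrA lerD ?ler_wpM2r //.
    by rewrite -[leLHS]addr0 lerD ?ler_wpM2r // ltW.
  have -> : r = s * M + s * M by rewrite -mulrDr /s divfK // gt_eqF // addr_gt0.
  by rewrite ltrDl mulr_gt0.
have inball' a b : 0 <= a <= s -> 0 <= b <= s -> ball p r (p + b *: w + a *: v).
  by move=> ? ?; rewrite addrAC; exact: inball.
have H12 y : ball p r y -> derivable f y v /\ derivable f y w.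
  by move=> /Hr [[]].
have H34 y : ball p r y -> derivable ('D_v f) y w /\ derivable ('D_w f) y v.
  by move=> /Hr [[]].
have HA y : ball p r y -> A y by move=> /Hr [].
have [||a [b [as_ bs E1]]] := @mixed_difference f p v w s s0.
- by move=> a b as_ bs; apply: (H12 _ (inball _ _ as_ bs)).1.
- by move=> a b as_ bs; apply: (H34 _ (inball _ _ as_ bs)).1.
have [||a' [b' [as' bs' E2]]] := @mixed_difference f p w v s s0.
- by move=> a' b' as' bs'; apply: (H12 _ (inball' _ _ bs' as')).2.
- by move=> a' b' as' bs'; apply: (H34 _ (inball' _ _ bs' as')).2.
have E : 'D_w ('D_v f) (p + a *: v + b *: w) * (s * s) =
         'D_v ('D_w f) (p + a' *: w + b' *: v) * (s * s).
  apply: etrans (esym E1) _; apply: etrans E2.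
  by rewrite [p + s *: w + s *: v]addrAC !opprB addrACA [RHS]addrACA [- _ + _]addrC.
have ss0 : s * s != 0 by rewrite mulf_neq0 ?gt_eqF.
exists (p + a *: v + b *: w), (p + a' *: w + b' *: v); split.
- exact/HA/inball.
- exact/HA/inball'.
- exact: (mulIf ss0 E).
Qed.

End symmetry.

Lemma derive_comm (R : realType) (V : normedModType R) m n
    (f : V -> 'M[R]_(m, n)) (p v w : V) :
  (\forall x \near p, differentiable f x) ->
  (\forall x \near p, differentiable ('D_v f) x) ->
  (\forall x \near p, differentiable ('D_w f) x) ->
  {for p, continuous ('D_w ('D_v f))} ->
  {for p, continuous ('D_v ('D_w f))} ->
  'D_w ('D_v f) p = 'D_v ('D_w f) p.
Proof.
move=> d1 d2 d3 c1 c2; apply/matrixP => i j.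
(* near [p], derivatives of the entry [g] are entries of the derivatives of [f] *)
pose g x := f x i j.
have dg u : \forall x \near p, 'D_u f x i j = 'D_u g x.
  by apply: filterS d1 => x dx; apply: derive_mx_coord; apply: diff_derivable.
have ddg u u' : (\forall x \near p, differentiable ('D_u f) x) ->
    \forall x \near p, 'D_u' ('D_u f) x i j = 'D_u' ('D_u g) x.
  move=> du; have := near_join (dg u); move: du; apply: filterS2 => x du dgu.
  transitivity ('D_u' (fun y => 'D_u f y i j) x).
    by apply: derive_mx_coord; apply: diff_derivable.
  exact: near_eq_derive.
have cg u u' : (\forall x \near p, differentiable ('D_u f) x) ->
    {for p, continuous ('D_u' ('D_u f))} -> {for p, continuous ('D_u' ('D_u g))}.
  move=> du c; have ddgu := ddg _ u' du.
  have cij : {for p, continuous (fun x => 'D_u' ('D_u f) x i j)}.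
    apply: (@continuous_comp _ _ _ ('D_u' ('D_u f)) (fun M : 'M[R]_(m, n) => M i j)).
      exact: c.
    exact/differentiable_continuous/differentiable_coord.
  rewrite /prop_for /continuous_at -(nbhs_singleton ddgu).
  by apply: cvg_trans cij; apply: near_eq_cvg.
apply: etrans (nbhs_singleton (ddg v w d2)) _.
apply: etrans (esym (nbhs_singleton (ddg w v d3))).
have dvbl u : \forall x \near p, derivable g x u.
  by apply: filterS d1 => x dx; apply: (derivable_mxP f x u).1; apply: diff_derivable.
have ddvbl u u' : (\forall x \near p, differentiable ('D_u f) x) ->
    \forall x \near p, derivable ('D_u g) x u'.
  move=> du; have := near_join (dg u); move: du; apply: filterS2 => x du dgu.
  apply: near_eq_derivable dgu _.
  by apply: (derivable_mxP ('D_u f) x u').1; apply: diff_derivable.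
apply: derive_comm_scalar.
- exact: dvbl.
- exact: dvbl.
- exact: ddvbl.
- exact: ddvbl.
- exact: cg.
- exact: cg.
Qed.

(** * Bilinear calculus on matrices *)

Lemma differentiable_mx (R : numFieldType) (V : normedModType R) m n
    (M : V -> 'M[R]_(m, n)) (x : V) :
  (forall i j, differentiable (fun y => M y i j) x) -> differentiable M x.
Proof.
move=> dM.
have -> : M = \sum_i \sum_j (fun y => M y i j *: delta_mx i j).
  apply/funext => y; rewrite [LHS]matrix_sum_delta fct_sumE.
  by apply: eq_bigr => i _; rewrite fct_sumE.
apply: differentiable_sum => i; apply: differentiable_sum => j.
exact: differentiableZl.
Qed.

Lemma differentiable_coord_comp (R : numFieldType) (V : normedModType R) m n
    (M : V -> 'M[R]_(m, n)) (x : V) i j :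
  differentiable M x -> differentiable (fun y => M y i j) x.
Proof.
move=> dM; apply: (@differentiable_comp _ _ _ _ M (fun N : 'M[R]_(m, n) => N i j)).
  exact: dM.
exact: differentiable_coord.
Qed.

Lemma mx_linear_continuous (R : numFieldType) m n (W : normedModType R)
  (f : {linear 'M[R]_(m, n) -> W}) : continuous f.
Proof.
have fE : (f : _ -> _) = \sum_i \sum_j (fun y : 'M[R]_(m, n) => y i j *: f (delta_mx i j)).
  apply/funext => y; rewrite [in LHS](matrix_sum_delta y) fct_sumE linear_sum.
  apply: eq_bigr => i _; rewrite fct_sumE linear_sum.
  by apply: eq_bigr => j _; rewrite linearZ.
move=> x; apply: differentiable_continuous; rewrite fE.
apply: differentiable_sum => i; apply: differentiable_sum => j.
by apply: differentiableZl; apply: differentiable_coord.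
Qed.

Lemma id_differentiable (R : numFieldType) (V : normedModType R) (x : V) :
  differentiable (fun y => y) x.
Proof. by have [] := is_diff_id x. Qed.

Lemma fst_differentiable (R : numFieldType) (V W : normedModType R) (x : V * W) :
  differentiable fst x.
Proof.
have f_cont : continuous (fst : (V * W)%type -> V) by move=> y; exact: cvg_fst.
exact: (linear_differentiable (f := fst : {linear (V * W)%type -> V}) x f_cont).

Qed.

Lemma snd_differentiable (R : numFieldType) (V W : normedModType R) (x : V * W) :
  differentiable snd x.
Proof.
have f_cont : continuous (snd : (V * W)%type -> W) by move=> y; exact: cvg_snd.
exact: (linear_differentiable (f := snd : {linear (V * W)%type -> W}) x f_cont).

Qed.

Section bilinear.
Context {R : realFieldType} {W : normedModType R} {m n p q : nat}.
Variable B : 'M[R]_(m, n) -> 'M[R]_(p, q) -> W.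
Hypothesis Bl : forall y, linear (B^~ y).
Hypothesis Br : forall x, linear (B x).

Lemma bilinear_sum_delta (x : 'M[R]_(m, n)) (y : 'M[R]_(p, q)) :
  B x y = \sum_i \sum_j \sum_k \sum_l
    (x i j * y k l) *: B (delta_mx i j) (delta_mx k l).
Proof.
pose f y : {linear _ -> W} := HB.pack (B^~ y) (GRing.isLinear.Build _ _ _ _ (B^~ y) (Bl y)).
pose g x : {linear _ -> W} := HB.pack (B x) (GRing.isLinear.Build _ _ _ _ (B x) (Br x)).
transitivity (f y (\sum_i \sum_j x i j *: delta_mx i j)).
  by rewrite -matrix_sum_delta.
rewrite linear_sum; apply: eq_bigr => i _.
rewrite linear_sum; apply: eq_bigr => j _; rewrite linearZ /=.
transitivity (x i j *: g (delta_mx i j) (\sum_k \sum_l y k l *: delta_mx k l)).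
  by rewrite -matrix_sum_delta.
rewrite linear_sum scaler_sumr.
apply: eq_bigr => k _; rewrite linear_sum scaler_sumr; apply: eq_bigr => l _.
by rewrite linearZ /= scalerA.
Qed.

Lemma differentiable_bilinear (V : normedModType R) (a : V -> 'M[R]_(m, n)) (b : V -> 'M[R]_(p, q)) x :
  differentiable a x -> differentiable b x ->
  differentiable (fun y => B (a y) (b y)) x.
Proof.
move=> da db.
have -> : (fun y => B (a y) (b y)) = \sum_i \sum_j \sum_k \sum_l
    (fun y => (a y i j * b y k l) *: B (delta_mx i j) (delta_mx k l)).
  apply/funext => y; rewrite bilinear_sum_delta !fct_sumE; apply: eq_bigr => i _.
  rewrite !fct_sumE; apply: eq_bigr => j _; rewrite !fct_sumE; apply: eq_bigr => k _.
  by rewrite !fct_sumE.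
do 4!(apply: differentiable_sum => ?).
apply: differentiableZl; apply: differentiableM; exact: differentiable_coord_comp.
Qed.
 
Lemma derive_bilinear (V : normedModType R) (a : V -> 'M[R]_(m, n)) (b : V -> 'M[R]_(p, q)) x v :
  differentiable a x -> differentiable b x ->
  'D_v (fun y => B (a y) (b y)) x = B ('D_v a x) (b x) + B (a x) ('D_v b x).
Proof.
move=> da db.
have bilin : bilinear_for
  (GRing.Scale.Law.clone _ _ *:%R _) (GRing.Scale.Law.clone _ _ *:%R _) B.
  by split=> [u|u] c y z /=; [exact: Bl|exact: Br].
pose bm := bilinear_isBilinear.Build R _ _ _ _ _ _ bilin.
pose f : {bilinear _ -> _ -> _} := HB.pack B bm.
have fc : continuous (fun p => f p.1 p.2).
  move=> z; apply: differentiable_continuous; apply: differentiable_bilinear.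
    exact: fst_differentiable.
  exact: snd_differentiable.
have dpair : differentiable (fun y => (a y, b y)) x by apply: differentiable_pair.
have E : (fun y => B (a y) (b y)) = (fun p => f p.1 p.2) \o (fun y => (a y, b y)) by [].
rewrite !deriveE; [|exact: db|exact: da|exact: differentiable_bilinear].
rewrite E diff_comp; [|exact: dpair|exact: differentiable_bilin].
have E2 := @diff_bilin _ _ _ _ f (a x, b x) fc.
have E3 := diff_pair da db.
apply: etrans (congr1 (fun g => g ('d (fun y => (a y, b y)) x v)) E2) _.
apply: etrans (congr1 (fun g => f (a x) (g v).2 + f (g v).1 (b x)) E3) _.
by rewrite /= addrC.
Qed.

End bilinear.

(** * Charts of a Lie group and the adjoint action *)

(** Smoothness on a neighbourhood of a point. *)
Definition smooth_near {R : realType} {V W : normedModType R} (f : V -> W) (p : V) :=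
  exists2 U : set V, nbhs p U & smooth U f.

Section smooth_near.
Context {R : realType} {V W : normedModType R}.
Implicit Types (f : V -> W) (p v w : V).

Lemma smooth_near_differentiable f p :
  smooth_near f p -> \forall x \near p, differentiable f x.
Proof.
move=> [U Up fU]; apply: filterS Up => x Ux.
exact: (fU 1%N).1 (mem_set Ux).
Qed.

Lemma smooth_near_derive f p v : smooth_near f p -> smooth_near ('D_v f) p.
Proof. by move=> [U Up fU]; exists U => // k; apply: (fU k.+1).2. Qed.

Lemma smooth_near_diff1 f p : smooth_near f p -> differentiable f p.
Proof. by move=> /smooth_near_differentiable /nbhs_singleton. Qed.

Lemma smooth_near_comp_diff (U : normedModType R) (g : U -> V) u f :
  smooth_near f (g u) -> differentiable g u -> differentiable (fun x => f (g x)) u.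
Proof.
move=> fg dg; apply: (@differentiable_comp _ _ _ _ g f); first exact: dg.
exact: smooth_near_diff1.
Qed.

End smooth_near.

Lemma smooth_near_comm (R : realType) (V : normedModType R) m n
    (f : V -> 'M[R]_(m, n)) p v w :
  smooth_near f p -> 'D_w ('D_v f) p = 'D_v ('D_w f) p.
Proof.
move=> fp; apply: derive_comm.
- exact: smooth_near_differentiable.
- by apply: smooth_near_differentiable; apply: smooth_near_derive.
- by apply: smooth_near_differentiable; apply: smooth_near_derive.
- apply: differentiable_continuous; apply: smooth_near_diff1.
  by do 2!apply: smooth_near_derive.
- apply: differentiable_continuous; apply: smooth_near_diff1.
  by do 2!apply: smooth_near_derive.
Qed.

Lemma near_pair1 {T U : topologicalType} {p : T} {q : U} {P : T -> Prop} :
  (\forall x \near p, P x) -> \forall u \near (p, q), P u.1.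
Proof.
have c : fst x @[x --> (p, q)] --> p by apply: cvg_fst.
by move=> /c.
Qed.

Lemma near_pair2 {T U : topologicalType} {p : T} {q : U} {P : U -> Prop} :
  (\forall x \near q, P x) -> \forall u \near (p, q), P u.2.
Proof.
have c : snd x @[x --> (p, q)] --> q by apply: cvg_snd.
by move=> /c.
Qed.

Lemma cvg_pair1 {T U W : topologicalType} {p : T} {q : U} {f : T -> W} {w : W} :
  f x @[x --> p] --> w -> f u.1 @[u --> (p, q)] --> w.
Proof. by move=> fw A /fw; apply: near_pair1. Qed.

Lemma cvg_pair2 {T U W : topologicalType} {p : T} {q : U} {f : U -> W} {w : W} :
  f x @[x --> q] --> w -> f u.2 @[u --> (p, q)] --> w.
Proof. by move=> fw A /fw; apply: near_pair2. Qed.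

Section charts.
Context {R : realType} {G : lieGroupType R}.
Implicit Types (c : chart R G (@lie_dim R G)) (p q h : G).

Lemma chart_dom_near {c p} : chart_dom c p -> \forall x \near p, chart_dom c x.
Proof. by move=> cp; apply: open_nbhs_nbhs; split => //; exact: chart_dom_open. Qed.

Lemma chart_cvg {c p} : chart_dom c p -> c x @[x --> p] --> c p.
Proof. by move=> cp; apply: chart_fun_continuous; exact: mem_set. Qed.

Lemma chart_fK {c p} : chart_dom c p -> chart_inv c (c p) = p.
Proof. by move=> cp; apply: chart_funK; exact: mem_set. Qed.

Lemma chart_inv_cvg {c p} : chart_dom c p -> chart_inv c u @[u --> c p] --> p.
Proof.
move=> cp; rewrite -[X in _ --> X](chart_fK cp).
by apply: chart_inv_continuous; apply: mem_set; exists p.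
Qed.

Lemma chart_img_near {c p} : chart_dom c p ->
  \forall u \near c p, chart_dom c (chart_inv c u) /\ c (chart_inv c u) = u.
Proof.
move=> cp; have : nbhs (c p) (c @` chart_dom c).
  by apply: open_nbhs_nbhs; split; [exact: chart_img_open|exists p].
by apply: filterS => _ [x cx <-]; rewrite chart_fK.
Qed.

Lemma mul_cvg {T : Type} {F : set_system T} {FF : Filter F} {f g : T -> G} {a b : G} :
  f t @[t --> F] --> a -> g t @[t --> F] --> b -> (f t * g t)%g @[t --> F] --> (a * b)%g.
Proof.
move=> fa gb; have mc := @lie_mul_continuous R G (a, b).
apply: (@cvg_comp _ _ _ (fun t => (f t, g t)) (fun u => (u.1 * u.2)%g) _ _ _ _ mc).
exact: cvg_pair.
Qed.

(** The product of the group, read in charts, is smooth near every point. *)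
Lemma smooth_near_mul {x y z p q} : chart_dom (chart_at x) p ->
  chart_dom (chart_at y) q -> chart_dom (chart_at z) (p * q)%g ->
  smooth_near (fun u => chart_at z (chart_inv (chart_at x) u.1 *
                                    chart_inv (chart_at y) u.2)%g)
              (chart_at x p, chart_at y q).
Proof.
move=> px qy pqz; eexists; last exact: (@lie_mul_smooth R G x y z).
have n1 : \forall u \near (chart_at x p, chart_at y q),
   chart_dom (chart_at x) (chart_inv (chart_at x) u.1) /\
   chart_at x (chart_inv (chart_at x) u.1) = u.1.
  exact: near_pair1 (chart_img_near px).
have n2 : \forall u \near (chart_at x p, chart_at y q),
   chart_dom (chart_at y) (chart_inv (chart_at y) u.2) /\
   chart_at y (chart_inv (chart_at y) u.2) = u.2.
  exact: near_pair2 (chart_img_near qy).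
have n3 : \forall u \near (chart_at x p, chart_at y q),
   chart_dom (chart_at z) (chart_inv (chart_at x) u.1 * chart_inv (chart_at y) u.2)%g.
  have c : (chart_inv (chart_at x) u.1 * chart_inv (chart_at y) u.2)%g
      @[u --> (chart_at x p, chart_at y q)] --> (p * q)%g.
    apply: mul_cvg; first exact: cvg_pair1 (chart_inv_cvg px).
    exact: cvg_pair2 (chart_inv_cvg qy).
  by move: (chart_dom_near pqz) => /c.
near=> u.
have [d1 e1] : chart_dom (chart_at x) (chart_inv (chart_at x) u.1) /\
   chart_at x (chart_inv (chart_at x) u.1) = u.1 by near: u.
have [d2 e2] : chart_dom (chart_at y) (chart_inv (chart_at y) u.2) /\
   chart_at y (chart_inv (chart_at y) u.2) = u.2 by near: u.
have d3 : chart_dom (chart_at z) (chart_inv (chart_at x) u.1 * chart_inv (chart_at y) u.2)%g by near: u.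
exists (chart_inv (chart_at x) u.1, chart_inv (chart_at y) u.2) => //=.
by rewrite e1 e2 -surjective_pairing.
Unshelve. all: by end_near. Qed.

Lemma smooth_near_inv {x y p} : chart_dom (chart_at x) p ->
  chart_dom (chart_at y) (p^-1)%g ->
  smooth_near (fun u => chart_at y ((chart_inv (chart_at x) u)^-1)%g) (chart_at x p).
Proof.
move=> px py; eexists; last exact: (@lie_inv_smooth R G x y).
have n1 := chart_img_near px.
have n2 : \forall u \near chart_at x p,
    chart_dom (chart_at y) ((chart_inv (chart_at x) u)^-1)%g.
  have c : ((chart_inv (chart_at x) u)^-1)%g @[u --> chart_at x p] --> (p^-1)%g.
    apply: (@cvg_comp _ _ _ (chart_inv (chart_at x)) (fun a => (a^-1)%g)).
      exact: chart_inv_cvg px.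
    exact: lie_inv_continuous.
  by move: (chart_dom_near py) => /c.
near=> u.
have [d1 e1] : chart_dom (chart_at x) (chart_inv (chart_at x) u) /\
   chart_at x (chart_inv (chart_at x) u) = u by near: u.
exists (chart_inv (chart_at x) u); last exact: e1.
by split; [exact: d1|near: u].
Unshelve. all: by end_near. Qed.

End charts.

Section adjoint.
Context {R : realType} {G : lieGroupType R}.
Local Notation lg := (lie_algebra R G).
Implicit Types (p q h : G) (X Y Z u v : lg).

Local Notation phi := (chart1 G).
Local Notation psi := (chart_inv (chart1 G)).
Local Notation e := (chart1 G 1%g).

Lemma chart1_dom : chart_dom phi 1%g. Proof. exact: chart_at_dom. Qed.

Lemma chart1_1 : psi e = 1%g. Proof. exact: chart_fK chart1_dom. Qed.

(** Conjugation by [h], read in the chart at the identity. *)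
Definition conj_chart h u : lg := phi (h * psi u * h^-1)%g.

Lemma AdE h X : Ad h X = 'D_X (conj_chart h) e. Proof. by []. Qed.

Lemma conj_chart1 h : conj_chart h e = e.
Proof. by rewrite /conj_chart chart1_1 mulg1 mulgV. Qed.

Lemma conj_cvg h : (h * psi u * h^-1)%g @[u --> e] --> (1 : G)%g.
Proof.
have h1 : (1 = h * 1 * h^-1 :> G)%g by rewrite mulg1 mulgV.
rewrite [X in _ --> X]h1; have c1 : (h * psi u)%g @[u --> e] --> (h * 1)%g.
  exact: mul_cvg (cvg_cst h) (chart_inv_cvg chart1_dom).
exact: mul_cvg c1 (cvg_cst (h^-1)%g).
Qed.

(** Conjugation fixes the identity, so near it the conjugate of a point of the
    chart is again in the chart. *)
Lemma conj_chartK h : \forall u \near e, psi (conj_chart h u) = (h * psi u * h^-1)%g.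
Proof.
have : \forall u \near e, chart_dom phi (h * psi u * h^-1)%g.
  by have c := @conj_cvg h; move: (chart_dom_near chart1_dom) => /c.
by apply: filterS => u du; exact: chart_fK du.
Qed.

Lemma conj_chart_diff h : differentiable (conj_chart h) e.
Proof.
have hh : chart_dom (chart_at h) h by exact: chart_at_dom.
have hV : chart_dom (chart_at (h^-1)%g) (h^-1)%g by exact: chart_at_dom.
have h1 : chart_dom (chart_at h) (h * 1)%g by rewrite mulg1.
have hhV : chart_dom phi (h * h^-1)%g by rewrite mulgV; exact: chart1_dom.
(* conjugation is a composite of two translations, the intermediate point being
   read in the chart around [h] *)
pose g1 u := chart_at h (h * psi u)%g.
pose g2 u := phi (chart_inv (chart_at h) u * h^-1)%g.
have dg1 : differentiable g1 e.
  have := smooth_near_mul hh chart1_dom h1.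
  move=> /(@smooth_near_comp_diff _ _ _ _ (fun u => (chart_at h h, u)) e).
  rewrite /= (chart_fK hh); apply; apply: differentiable_pair.
    exact: differentiable_cst.
  exact: id_differentiable.
have dg2 : differentiable g2 (chart_at h h).
  have := smooth_near_mul hh hV hhV.
  move=> /(@smooth_near_comp_diff _ _ _ _ (fun u => (u, chart_at h^-1 h^-1)%g) (chart_at h h)).
  rewrite /= (chart_fK hV); apply; apply: differentiable_pair.
    exact: id_differentiable.
  exact: differentiable_cst.
have g1e : g1 e = chart_at h h by rewrite /g1 chart1_1 mulg1.
apply: (@near_eq_differentiable _ _ _ (g2 \o g1)).
  have c : (h * psi u)%g @[u --> e] --> (h * 1)%g.
    exact: mul_cvg (cvg_cst h) (chart_inv_cvg chart1_dom).
  have H := c _ (chart_dom_near h1); near=> u.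
  have du : chart_dom (chart_at h) (h * psi u)%g by near: u.
  by rewrite /g2 /g1 /= (chart_fK du).
by apply: differentiable_comp; [exact: dg1|rewrite g1e; exact: dg2].
Unshelve. all: by end_near. Qed.

Lemma Ad_linear h : linear (Ad h : lg -> lg).
Proof.
move=> a X Y; rewrite !AdE !deriveE; first exact: linearP.
all: exact: conj_chart_diff.
Qed.

Lemma Ad1 X : Ad 1%g X = X.
Proof.
rewrite AdE; transitivity ('D_X (@id lg) e); last exact: derive_id.
apply: near_eq_derive; have := chart_img_near chart1_dom.
by apply: filterS => u [_ uE]; rewrite /conj_chart mul1g invg1 mulg1.
Qed.

Lemma AdM h1 h2 X : Ad (h1 * h2)%g X = Ad h1 (Ad h2 X).
Proof.
rewrite !AdE.
transitivity ('D_X (conj_chart h1 \o conj_chart h2) e).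
  apply: near_eq_derive; have := conj_chartK h2; apply: filterS => u uE.
  by rewrite /= {2}/conj_chart uE /conj_chart invgM !mulgA.
rewrite deriveE; last first.
  apply: differentiable_comp; [|rewrite conj_chart1]; exact: conj_chart_diff.
rewrite diff_comp; [|exact: conj_chart_diff|rewrite conj_chart1; exact: conj_chart_diff].
rewrite /= conj_chart1 !deriveE //; exact: conj_chart_diff.
Qed.

Lemma AdVK h X : Ad (h^-1)%g (Ad h X) = X.
Proof. by rewrite -AdM mulVg Ad1. Qed.

Lemma AdKV h X : Ad h (Ad (h^-1)%g X) = X.
Proof. by rewrite -AdM mulgV Ad1. Qed.

(** The adjoint action carries the velocity of a curve through the identity
    to the velocity of the conjugate curve. *)
Lemma Ad_velocity h (gamma : R -> G) X : gamma 0 = 1%g ->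
  gamma t @[t --> (0 : R)] --> (1 : G)%g ->
  is_derive (0 : R) (1 : R) (fun t => phi (gamma t)) X ->
  is_derive (0 : R) (1 : R) (fun t => phi (h * gamma t * h^-1)%g) (Ad h X).
Proof.
move=> g0 cg [dg gX].
have fE : \forall t \near (0 : R),
    (conj_chart h \o (fun t => phi (gamma t))) t = phi (h * gamma t * h^-1)%g.
  have H := cg _ (chart_dom_near chart1_dom); near=> t.
  have dt : chart_dom phi (gamma t) by near: t.
  by rewrite /= /conj_chart (chart_fK dt).
apply: near_eq_is_derive fE _.
have dg' : differentiable (fun t => phi (gamma t)) 0 by apply/derivable1_diffP.
have dc : differentiable (conj_chart h) (phi (gamma 0)).
  by rewrite g0; exact: conj_chart_diff.
split; first by apply: diff_derivable; exact: differentiable_comp.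
rewrite deriveE; last exact: differentiable_comp.
rewrite diff_comp; [|exact: dg'|exact: dc].
rewrite /= g0 AdE [RHS]deriveE; last exact: conj_chart_diff.
by congr ('d _ _ _); rewrite -gX deriveE //; exact: dg'.
Unshelve. all: by end_near. Qed.

End adjoint.

(** * The differential of the adjoint representation *)

Lemma derive_comp (R : numFieldType) (U V W : normedModType R)
    (g : U -> V) (f : V -> W) (x u : U) :
  differentiable g x -> differentiable f (g x) ->
  'D_u (fun y => f (g y)) x = 'D_('D_u g x) f (g x).
Proof.
move=> dg df; rewrite (deriveE _ df) (deriveE u dg).
rewrite deriveE; last exact: (differentiable_comp (f := g) (g := f)).
by rewrite (diff_comp (f := g) (g := f)).
Qed.

Lemma derive_comp_pair1 (R : numFieldType) (U V V' W : normedModType R)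
    (g : U -> V) (q : V') (f : V * V' -> W) (x u : U) :
  differentiable g x -> differentiable f (g x, q) ->
  'D_u (fun y => f (g y, q)) x = 'D_('D_u g x, 0) f (g x, q).
Proof.
move=> dg df; have dpair : differentiable (fun y => (g y, q)) x.
  by apply: differentiable_pair; [exact: dg|exact: differentiable_cst].
rewrite (derive_comp u dpair df); congr ('D_ _ f _).
rewrite (deriveE _ dpair) (deriveE _ dg).
have E := diff_pair dg (differentiable_cst q x).
apply: etrans (congr1 (fun g => g u) E) _ => /=.
by rewrite diff_cst.
Qed.

Section adjoint_derivative.
Context {R : realType} {G : lieGroupType R}.
Local Notation lg := (lie_algebra R G).
Implicit Types (p q h : G) (X Y Z u v : lg).

Local Notation phi := (chart1 G).
Local Notation psi := (chart_inv (chart1 G)).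
Local Notation e := (chart1 G 1%g).

(** The multiplication of [G], read in the chart at the identity. *)
Definition mul_chart (u : lg * lg) : lg := phi (psi u.1 * psi u.2)%g.

Local Notation m := mul_chart.

Lemma mul_chart_smooth : smooth_near m (e, e).
Proof.
apply: smooth_near_mul; [exact: chart1_dom|exact: chart1_dom|].
by rewrite mulg1; exact: chart1_dom.
Qed.

(** The inversion of [G], read in the chart at the identity. *)
Definition inv_chart (u : lg) : lg := phi ((psi u)^-1)%g.

Lemma inv_chart_smooth : smooth_near inv_chart e.
Proof.
apply: smooth_near_inv; first exact: chart1_dom.
by rewrite invg1; exact: chart1_dom.
Qed.

Lemma inv_chart1 : inv_chart e = e.
Proof. by rewrite /inv_chart chart1_1 invg1. Qed.

Lemma left_fieldE X v : left_field X v = 'D_(0, X) m (v, e).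
Proof. exact: (derive_pair2 m v e X). Qed.

Lemma left_field_diff X : differentiable (left_field X : lg -> lg) e.
Proof.
have -> : left_field X = fun v => 'D_(0, X) m (v, e).
  by apply/funext => v; exact: left_fieldE.
apply: (@smooth_near_comp_diff _ _ _ _ (fun v => (v, e)) e ('D_(0, X) m)).
  by apply: smooth_near_derive; exact: mul_chart_smooth.
by apply: differentiable_pair; [exact: id_differentiable|exact: differentiable_cst].
Qed.

Lemma derive_left_field X Z : 'D_Z (left_field X : lg -> lg) e =
  'D_(Z, 0) ('D_(0, X) m) (e, e).
Proof.
rewrite -(derive_pair1 ('D_(0, X) m) e Z e).
have -> : left_field X = fun v => 'D_(0, X) m (v, e); last by [].
by apply/funext => v; exact: left_fieldE.
Qed.

(** The matrix of the partial derivative of the product in its first factor,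
    acting on row vectors. *)
Definition dmul_chart (u : lg * lg) : 'M[R]_(@lie_dim R G) :=
  \matrix_j 'D_(delta_mx 0 j, 0) m u.

Lemma dmul_chartE Y (u : lg * lg) : differentiable m u -> 'D_(Y, 0) m u = Y *m dmul_chart u.
Proof.
move=> dm; rewrite mulmx_sum_row (deriveE (Y, 0) dm).
have -> : (Y, 0) = \sum_j (Y 0 j *: (delta_mx 0 j, 0 : lg)) :> lg * lg.
  rewrite [RHS]surjective_pairing.
  rewrite (raddf_sum (fst : {additive (lg * lg)%type -> lg})).
  rewrite (raddf_sum (snd : {additive (lg * lg)%type -> lg})) /=.
  congr (_, _); first by rewrite {1}[Y]row_sum_delta.
  by rewrite big1 // => j _; rewrite scaler0.
rewrite linear_sum; apply: eq_bigr => j _; rewrite linearZ /= rowK.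
by rewrite (deriveE _ dm).
Qed.

Lemma dmul_chart_diff : differentiable dmul_chart (e, e).
Proof.
apply: differentiable_mx => i j.
have -> : (fun y => dmul_chart y i j) = (fun y => 'D_(delta_mx 0 i, 0) m y 0 j).
  by apply/funext => y; rewrite mxE.
apply: differentiable_coord_comp; apply: smooth_near_diff1.
by apply: smooth_near_derive; exact: mul_chart_smooth.
Qed.

Lemma mul_chart_diff_near : \forall u \near (e, e), differentiable m u.
Proof. exact: smooth_near_differentiable mul_chart_smooth. Qed.

Lemma near_pair_comp {T : Type} {F : set_system T} {FF : Filter F}
    (f g : T -> lg) (a b : lg) (P : lg * lg -> Prop) :
  f t @[t --> F] --> a -> g t @[t --> F] --> b ->
  (\forall u \near (a, b), P u) -> \forall t \near F, P (f t, g t).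
Proof. by move=> fa gb; apply: (cvg_pair fa gb). Qed.

(** Differentiating (x y x^-1) x = x y in [y] at the identity: the left-invariant
    field of [X] is the right-invariant field of [Ad x X], at the point [x]. *)
Lemma left_field_Ad X : \forall v \near e,
  left_field X v = Ad (psi v) X *m dmul_chart (e, v).
Proof.
have H : \forall v \near e, differentiable m (e, v).
  by have := @near_pair_comp _ (nbhs e) _ _ _ e e _ (@cvg_cst _ e _ (nbhs e) _)
    (@cvg_id _ (nbhs e)) mul_chart_diff_near; apply.
near=> v.
have dm : differentiable m (e, v) by near: v.
rewrite -dmul_chartE; last exact: dm.
rewrite left_fieldE -(derive_pair2 m v e X) AdE.
have dc := @conj_chart_diff _ G (psi v).
have dm' : differentiable m (conj_chart (psi v) e, v) by rewrite conj_chart1.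
have E := @derive_comp_pair1 _ _ _ _ _ (conj_chart (psi v)) v m e X dc dm'.
rewrite conj_chart1 in E; apply: etrans E; apply: near_eq_derive.
have := conj_chartK (psi v); apply: filterS => u uE.
by rewrite /mul_chart /= uE mulgVK.
Unshelve. all: by end_near. Qed.

(** Differentiating (x y) x^-1 in [y] at the identity gives a formula for [Ad x X]
    in which only derivatives of smooth functions of [x] occur. *)
Lemma Ad_left_field X : \forall v \near e,
  Ad (psi v) X = left_field X v *m dmul_chart (v, inv_chart v).
Proof.
have ci : inv_chart v @[v --> e] --> e.
  rewrite -[X in _ --> X]inv_chart1; apply: differentiable_continuous.
  exact: smooth_near_diff1 inv_chart_smooth.
have c3 : ((psi v)^-1)%g @[v --> e] --> (1 : G)%g.
  rewrite -[X in _ --> X]invg1.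
  apply: (@cvg_comp _ _ _ psi (fun a => (a^-1)%g)); first exact: chart_inv_cvg chart1_dom.
  exact: lie_inv_continuous.
have H1 : \forall v \near e, differentiable m (v, inv_chart v).
  by have := @near_pair_comp _ (nbhs e) _ _ _ e e _ (@cvg_id _ (nbhs e))
    ci mul_chart_diff_near; apply.
have H2 : \forall v \near e, differentiable m (v, e).
  by have := @near_pair_comp _ (nbhs e) _ _ _ e e _ (@cvg_id _ (nbhs e))
    (@cvg_cst _ e _ (nbhs e) _) mul_chart_diff_near; apply.
have H3 := c3 _ (chart_dom_near chart1_dom).
have H4 := chart_img_near (@chart1_dom R G).
have H12 : \forall v \near e, differentiable m (v, inv_chart v) /\ differentiable m (v, e).
  by apply: filterI; [exact: H1|exact: H2].
apply: filterS3 H12 H3 H4 => v [dm1 dm2] dom3 [dom4 vE].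
have mve : m (v, e) = v by rewrite /mul_chart /= chart1_1 mulg1.
rewrite -dmul_chartE; last exact: dm1.
rewrite left_fieldE -(derive_pair2 m v e X) AdE.
have dc : differentiable (fun u => m (v, u)) e.
  apply: (@differentiable_comp _ _ _ _ (fun u => (v, u)) m); last exact: dm2.
  by apply: differentiable_pair; [exact: differentiable_cst|exact: id_differentiable].
have dm' : differentiable m (m (v, e), inv_chart v) by rewrite mve.
have E := @derive_comp_pair1 _ _ _ _ _ (fun u => m (v, u)) (inv_chart v) m e X dc dm'.
rewrite mve in E; apply: etrans E; apply: near_eq_derive.
have c5 : (psi v * psi u)%g @[u --> e] --> (psi v * 1)%g.
  exact: mul_cvg (cvg_cst (psi v)) (chart_inv_cvg chart1_dom).
rewrite mulg1 in c5.
have H5 := c5 _ (chart_dom_near dom4); near=> u.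
have dom5 : chart_dom phi (psi v * psi u)%g by near: u.
by rewrite /mul_chart /inv_chart /= (chart_fK dom5) (chart_fK dom3).
Unshelve. all: by end_near. Qed.

Lemma Ad_diff X : differentiable (fun v => Ad (psi v) X) e.
Proof.
apply: (@near_eq_differentiable _ _ _
  (fun v => left_field X v *m dmul_chart (v, inv_chart v))).
  by apply: filterS (Ad_left_field X) => v.
apply: differentiable_bilinear.
- by move=> y a u v; rewrite mulmxDl scalemxAl.
- by move=> y a u v; rewrite mulmxDr scalemxAr.
- exact: left_field_diff.
- apply: (@differentiable_comp _ _ _ _ (fun v => (v, inv_chart v)) dmul_chart).
    apply: differentiable_pair; first exact: id_differentiable.
    exact: smooth_near_diff1 inv_chart_smooth.
  by rewrite inv_chart1; exact: dmul_chart_diff.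
Qed.

(** The differential of the adjoint representation at the identity is the
    Lie bracket.  This is the derivative of [left_field_Ad] at the identity. *)
Lemma derive_Ad X Z : 'D_Z (fun v => Ad (psi v) X) e = bracket Z X.
Proof.
have dC : differentiable (fun v => dmul_chart (e, v)) e.
  apply: (@differentiable_comp _ _ _ _ (fun v => (e, v)) dmul_chart).
    by apply: differentiable_pair; [exact: differentiable_cst|exact: id_differentiable].
  exact: dmul_chart_diff.
have C1 Y : Y *m dmul_chart (e, e) = Y.
  rewrite -dmul_chartE; last exact: nbhs_singleton mul_chart_diff_near.
  rewrite -(derive_pair1 m e Y e); transitivity ('D_Y (@id lg) e); last exact: derive_id.
  apply: near_eq_derive; apply: filterS (chart_img_near chart1_dom) => u [_ uE].
  by rewrite /mul_chart /= chart1_1 mulg1.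
have E1 : 'D_Z (left_field X : lg -> lg) e =
    'D_Z (fun v => Ad (psi v) X) e + 'D_(0, Z) ('D_(X, 0) m) (e, e).
  have -> := near_eq_derive Z (left_field_Ad X).
  have := @derive_bilinear R _ _ _ _ _ mulmx _ _ _ (fun v => Ad (psi v) X)
    (fun v => dmul_chart (e, v)) e Z.
  move=> ->.
  - rewrite C1 chart1_1 Ad1; congr (_ + _).
    rewrite -(derive_pair2 ('D_(X, 0) m) e e Z).
    have -> : X *m 'D_Z (fun x => dmul_chart (e, x)) e =
              'D_Z (fun x => X *m dmul_chart (e, x)) e.
      have := @derive_bilinear R _ _ _ _ _ mulmx _ _ _ (fun v => X)
        (fun v => dmul_chart (e, v)) e Z.
      move=> ->.
      + by rewrite derive_cst mul0mx add0r.
      + by move=> y a u v; rewrite mulmxDl scalemxAl.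
      + by move=> y a u v; rewrite mulmxDr scalemxAr.
      + exact: differentiable_cst.
      + exact: dC.
    apply: near_eq_derive; have H : \forall v \near e, differentiable m (e, v).
  by have := @near_pair_comp _ (nbhs e) _ _ _ e e _ (@cvg_cst _ e _ (nbhs e) _)
    (@cvg_id _ (nbhs e)) mul_chart_diff_near; apply.
near=> v.
    have dm : differentiable m (e, v) by near: v.
    exact: esym (dmul_chartE X dm).
  - by move=> y a u v; rewrite mulmxDl scalemxAl.
  - by move=> y a u v; rewrite mulmxDr scalemxAr.
  - exact: Ad_diff.
  - exact: dC.
have S := @smooth_near_comm _ _ _ _ m _ (X, 0) (0, Z) mul_chart_smooth.
have E2 := etrans (derive_left_field Z X) (esym S).
apply: esym; apply: etrans (congr2 (fun a b : lg => a - b) E1 E2) _.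
exact: addrK.
Unshelve. all: by end_near. Qed.

End adjoint_derivative.

(** * The Lie algebra of a Lie group *)

(** A function that satisfies [linear] underlies a bundled linear map. *)
Lemma to_linear (R : pzRingType) (V W : lmodType R) (f : V -> W) :
  linear f -> {g : {linear V -> W} | (g : V -> W) = f}.
Proof.
move=> fl.
by exists (HB.pack f (GRing.isLinear.Build R V W *:%R f fl) : {linear V -> W}).
Qed.

Lemma mx_linear_differentiable (R : numFieldType) m n (W : normedModType R)
    (f : 'M[R]_(m, n) -> W) x : linear f -> differentiable f x.
Proof.
move=> /to_linear [g <-]; apply: linear_differentiable.
exact: mx_linear_continuous.
Qed.

Lemma derive_mx_linear (R : numFieldType) m n (W : normedModType R)
    (f : 'M[R]_(m, n) -> W) x v : linear f -> 'D_v f x = f v.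
Proof.
move=> fl; rewrite (deriveE v (mx_linear_differentiable x fl)).
have [g <-] := to_linear fl.
by rewrite (diff_lin x (@mx_linear_continuous _ _ _ _ g)).
Qed.

Lemma alternating_linearr (R : pzRingType) (V : lmodType R) (b : V -> V -> V) :
  (forall x y, b x y = - b y x) -> (forall y, linear (b^~ y)) ->
  forall x, linear (b x).
Proof.
move=> bC bl x a y z; have E := bl x a y z.
by rewrite bC E (bC x y) (bC x z) opprD scalerN.
Qed.

Section bracket.
Context {R : realType} {G : lieGroupType R}.
Local Notation lg := (lie_algebra R G).
Implicit Types (p q h : G) (X Y Z u v : lg).

Local Notation phi := (chart1 G).
Local Notation psi := (chart_inv (chart1 G)).
Local Notation e := (chart1 G 1%g).

Lemma bracketC X Y : bracket X Y = - bracket Y X.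
Proof. by rewrite /bracket opprB. Qed.

(* Unification may otherwise unfold the bracket into derivatives. *)
#[local] Opaque bracket Ad.

Lemma bracket_linearl Y : linear (fun X : lg => bracket X Y).
Proof.
move=> a X1 X2; rewrite -!derive_Ad.
rewrite !(deriveE _ (Ad_diff Y)).
exact: linearP.
Qed.

Lemma bracket_linearr X : linear (bracket X : lg -> lg).
Proof. exact: alternating_linearr bracketC bracket_linearl X. Qed.

(** The derivative at the identity, in the direction [X], of the two functions
    [Ad h (Ad x Y)] and [Ad (h x h^-1) (Ad h Y)] of [x], which agree. *)
Lemma Ad_bracket h X Y : Ad h (bracket X Y) = bracket (Ad h X) (Ad h Y).
Proof.
have dAdh v : differentiable (Ad h : lg -> lg) v.
  exact: mx_linear_differentiable (Ad_linear h).
have dA1 : differentiable (fun v => Ad (psi v) (Ad h Y)) (conj_chart h e).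
  by rewrite conj_chart1; exact: Ad_diff.
have E1 := @derive_comp _ _ _ _ (fun v => Ad (psi v) Y) (Ad h : lg -> lg) e X
  (Ad_diff Y) (dAdh _).
have E2 := @derive_comp _ _ _ _ (conj_chart h) (fun v => Ad (psi v) (Ad h Y)) e X
  (conj_chart_diff h) dA1.
have E1' := etrans (etrans E1 (derive_mx_linear _ _ (Ad_linear h)))
  (congr1 (Ad h) (derive_Ad Y X)).
have E2' := etrans (etrans E2 (congr1 (fun x => 'D_(Ad h X) _ x) (conj_chart1 h)))
  (derive_Ad (Ad h Y) (Ad h X)).
apply: etrans (esym E1') (etrans _ E2'); apply: near_eq_derive.
have := conj_chartK h; apply: filterS => u uE.
by rewrite uE -!AdM -!mulgA mulVg mulg1.
Qed.

(** The derivative, in the direction [X], of the invariance of the bracket under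
    [Ad]. *)
Lemma jacobi X Y Z :
  bracket X (bracket Y Z) = bracket (bracket X Y) Z + bracket Y (bracket X Z).
Proof.
have := @derive_bilinear R lg _ _ _ _ (fun a b : lg => bracket a b)
  bracket_linearl bracket_linearr _ (fun v => Ad (psi v) Y)
  (fun v => Ad (psi v) Z) e X (Ad_diff Y) (Ad_diff Z).
rewrite !derive_Ad !chart1_1 !Ad1 => <-; rewrite -derive_Ad.
apply: (congr1 (fun f : lg -> lg => 'D_X f e)).
by apply/funext => v; exact: Ad_bracket.
Qed.

(** An [Ad]-invariant bilinear form is [ad]-invariant. *)
Lemma ad_invariant (B : lg -> lg -> R) :
  (forall Y, linear (B^~ Y : lg -> R^o)) -> (forall X, linear (B X : lg -> R^o)) ->
  (forall h X Y, B (Ad h X) (Ad h Y) = B X Y) ->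
  forall X Y Z, B (bracket X Y) Z + B Y (bracket X Z) = 0.
Proof.
move=> Bl Br BAd X Y Z.
have := @derive_bilinear R R^o _ _ _ _ B Bl Br _ (fun v => Ad (psi v) Y)
  (fun v => Ad (psi v) Z) e X (Ad_diff Y) (Ad_diff Z).
rewrite !derive_Ad !chart1_1 !Ad1 => <-.
have -> : (fun y => B (Ad (psi y) Y) (Ad (psi y) Z)) = cst (B Y Z).
  by apply/funext => v; exact: BAd.
exact: derive_cst.
Qed.

Lemma Ad_cvg1 X : Ad h X @[h --> (1 : G)%g] --> X.
Proof.
have c : (fun v => Ad (psi v) X) (phi h) @[h --> (1 : G)%g] --> X.
  rewrite -[X in _ --> X](Ad1 X) -[in X in _ --> X]chart1_1.
  apply: (@cvg_comp _ _ _ phi (fun v => Ad (psi v) X)).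
    exact: chart_cvg chart1_dom.
  exact: (differentiable_continuous (Ad_diff X)).
apply: cvg_trans c; apply: near_eq_cvg.
apply: filterS (chart_dom_near chart1_dom) => h dh.
by rewrite (chart_fK dh).
Qed.

Lemma Ad_continuous X : continuous (fun h : G => Ad h X).
Proof.
move=> h0.
have c1 : (h0^-1 * h)%g @[h --> h0] --> (1 : G)%g.
  rewrite -[X in _ --> X](mulVg h0).
  exact: mul_cvg (cvg_cst (h0^-1)%g) cvg_id.
have c2 : Ad (h0^-1 * h)%g X @[h --> h0] --> X.
  have := cvg_comp (fun h => h0^-1 * h)%g (fun h : G => Ad h X) c1 (@Ad_cvg1 X).
  apply.
have c3 : Ad h0 (Ad (h0^-1 * h)%g X) @[h --> h0] --> Ad h0 X.
  apply: (@cvg_comp _ _ _ (fun h => Ad (h0^-1 * h)%g X) (Ad h0 : lg -> lg) _ _ _ c2).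
  apply: differentiable_continuous.
  exact: mx_linear_differentiable (Ad_linear h0).
apply: cvg_trans c3; apply: near_eq_cvg; near=> h.
by rewrite -AdM mulVKg.
Unshelve. all: by end_near. Qed.

(** The entries of [Ad h X] are bounded because [Ad] is continuous on a compact
    group. *)
Lemma Ad_bounded X : compact [set: G] -> exists C : R, forall h j, `|Ad h X 0 j| <= C.
Proof.
move=> Gc.
have /compact_bounded [M [_ HM]] : compact ((fun h : G => Ad h X) @` [set: G]).
  by apply: continuous_compact Gc; apply: continuous_subspaceT; exact: Ad_continuous.
exists (M + 1) => h j.
have : `|Ad h X| <= M + 1 by apply: HM; [rewrite ltrDl|exists h].
apply: le_trans; rewrite [leRHS]/Num.Def.normr/= mx_normrE.
exact: (le_bigmax _ _ (0, j)).
Qed.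

Lemma derive_Ad_curve (gamma : R -> G) X Y : gamma 0 = 1%g ->
  gamma t @[t --> (0 : R)] --> (1 : G)%g ->
  is_derive (0 : R) (1 : R) (fun t => phi (gamma t)) X ->
  is_derive (0 : R) (1 : R) (fun t => Ad (gamma t) Y) (bracket X Y).
Proof.
move=> g0 cg [dg gX].
have fE : \forall t \near (0 : R),
    ((fun v => Ad (psi v) Y) \o (fun t => phi (gamma t))) t = Ad (gamma t) Y.
  have H := cg _ (chart_dom_near chart1_dom); near=> t.
  have dt : chart_dom phi (gamma t) by near: t.
  by rewrite /= (chart_fK dt).
apply: near_eq_is_derive fE _.
have dg' : differentiable (fun t => phi (gamma t)) 0 by apply/derivable1_diffP.
have dA : differentiable (fun v => Ad (psi v) Y) (phi (gamma 0)).
  by rewrite g0; exact: Ad_diff.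
split; first by apply: diff_derivable; exact: differentiable_comp.
apply: etrans (derive_comp (1 : R) dg' dA) _.
by rewrite gX g0 derive_Ad.
Unshelve. all: by end_near. Qed.

Section subgroup.
Variables (K : set G) (k : {vspace lg}).
Hypotheses (K_subgroup : compact_subgroup K) (k_def : is_lie_algebra_of K k).

Lemma one_parameter0 (gamma : R -> G) :
  (forall s t, gamma (s + t) = (gamma s * gamma t)%g) -> gamma 0 = 1%g.
Proof.
move=> gD; have /(congr1 (fun x => (gamma 0)^-1 * x)%g) := gD 0 0.
by rewrite addr0 mulVg mulKg.
Qed.

(** Conjugation by [h] in [K] permutes the one-parameter subgroups of [K]. *)
Lemma Ad_subalgebra h X : K h -> X \in k -> Ad h X \in k.
Proof.
move=> Kh /k_def [gamma [gc gD gK gX]]; have g0 := one_parameter0 gD.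
have [_ _ KM KV] := K_subgroup.
apply/k_def; exists (fun t => (h * gamma t * h^-1)%g); split.
- move=> t.
  have c1 : (h * gamma s)%g @[s --> t] --> (h * gamma t)%g.
    exact: mul_cvg (cvg_cst h) (gc t).
  have c2 : (h * gamma s * h^-1)%g @[s --> t] --> (h * gamma t * h^-1)%g.
    exact: mul_cvg c1 (cvg_cst (h^-1)%g).
  exact: c2.
- by move=> s t; rewrite gD -!mulgA (mulgA h^-1 h)%g mulVg mul1g.
- by move=> t; exact: KM (KM _ _ Kh (gK t)) (KV _ Kh).
- by apply: Ad_velocity => //; rewrite -g0; exact: gc.
Qed.

(** A subspace contains the velocity of every curve that stays in it. *)
Lemma derive_vspace (f : R -> lg) Y : (forall t, f t \in k) ->
  is_derive (0 : R) (1 : R) f Y -> Y \in k.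
Proof.
move=> fk [df fY].
have df' : differentiable f 0 by apply/derivable1_diffP.
pose g (x : lg) := x - projv k x.
have gl : linear g.
  by move=> a x y; rewrite /g linearP scalerBr opprD addrACA.
have g0 x : (x \in k) = (g x == 0).
  rewrite /g subr_eq0 eq_sym; apply/idP/eqP => [/projv_id //|<-].
  exact: memv_proj.
have E := derive_comp (1 : R) df' (mx_linear_differentiable (f 0) gl).
rewrite g0 -fY -(derive_mx_linear (f 0) _ gl) -E.
have -> : (fun y => g (f y)) = cst 0.
  by apply/funext => t; apply/eqP; rewrite -g0.
by rewrite derive_cst.
Qed.

(** [bracket X Y] is the velocity of [Ad (exp (t X)) Y], a curve in [k]. *)
Lemma bracket_subalgebra X Y : X \in k -> Y \in k -> bracket X Y \in k.
Proof.
move=> /k_def [gamma [gc gD gK gX]] Yk; have g0 := one_parameter0 gD.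
apply: (@derive_vspace (fun t => Ad (gamma t) Y)).
  by move=> t; apply: Ad_subalgebra.
by apply: derive_Ad_curve => //; rewrite -g0; exact: gc.
Qed.

End subgroup.
End bracket.

(** * Inner products, orthonormal bases and traces *)

(** [R^o] is [R] as a module over itself, so that [linear] applies to forms. *)
Record inner_product (R : rcfType) (V : lmodType R) (p : V -> V -> R) : Prop := {
  ip_linear : forall y, linear (p^~ y : V -> R^o);
  ip_sym : forall x y, p x y = p y x;
  ip_pos : forall x, x != 0 -> 0 < p x x
}.

Section inner_product.
Context {R : rcfType} {V : vectType R}.
Implicit Types (x y z : V) (U : {vspace V}).

Section theory.
Variable p : V -> V -> R.
Hypothesis ip : inner_product p.

Lemma ipDl x y z : p (x + y) z = p x z + p y z.
Proof. by have := ip_linear ip z 1 x y; rewrite !scale1r. Qed.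

Lemma ipZl c x z : p (c *: x) z = c * p x z.
Proof.
have p0 : p 0 z = 0.
  by have := ip_linear ip z 1 0 0; rewrite !scale1r addr0;
    move=> /(congr1 (fun t => t - p 0 z)); rewrite subrr addrK.
by have := ip_linear ip z c x 0; rewrite addr0 p0 addr0.
Qed.

Lemma ipDr x y z : p x (y + z) = p x y + p x z.
Proof. by rewrite !(ip_sym ip x) ipDl. Qed.

Lemma ipZr c x z : p x (c *: z) = c * p x z.
Proof. by rewrite !(ip_sym ip x) ipZl. Qed.

Lemma ip0l z : p 0 z = 0.
Proof. by rewrite -(scale0r 0) ipZl mul0r. Qed.

Lemma ip0r z : p z 0 = 0.
Proof. by rewrite (ip_sym ip) ip0l. Qed.

Lemma ipNl x z : p (- x) z = - p x z.
Proof. by rewrite -scaleN1r ipZl mulN1r. Qed.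

Lemma ipNr x z : p z (- x) = - p z x.
Proof. by rewrite (ip_sym ip) ipNl (ip_sym ip x). Qed.

Lemma ip_suml I (r : seq I) (F : I -> V) z :
  p (\sum_(i <- r) F i) z = \sum_(i <- r) p (F i) z.
Proof. by elim/big_rec2: _ => [|i y1 y2 _ <-]; rewrite ?ip0l ?ipDl. Qed.

Lemma ip_sumr I (r : seq I) (F : I -> V) z :
  p z (\sum_(i <- r) F i) = \sum_(i <- r) p z (F i).
Proof. by rewrite (ip_sym ip) ip_suml; apply: eq_bigr => i _; exact: ip_sym. Qed.

Lemma ip_ge0 x : 0 <= p x x.
Proof.
by have [->|/(ip_pos ip)/ltW//] := eqVneq x 0; rewrite ip0l.
Qed.

Lemma ip_eq0 x : (p x x == 0) = (x == 0).
Proof.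
have [->|/(ip_pos ip)/gt_eqF ->//] := eqVneq x 0; by rewrite ip0l eqxx.
Qed.

(** An orthonormal basis of the subspace [U], indexed by a finite type so that
    bases of complementary subspaces can be joined. *)
Record onb U (I : finType) (b : I -> V) : Prop := {
  onb_mem : forall i, b i \in U;
  onb_dot : forall i j, p (b i) (b j) = (i == j)%:R;
  onb_expand : forall x, x \in U -> x = \sum_i p x (b i) *: b i
}.

Lemma onb_parseval U (I : finType) (b : I -> V) x y : onb U b -> x \in U ->
  \sum_i p x (b i) * p y (b i) = p x y.
Proof.
move=> ob xU; rewrite [in RHS](onb_expand ob xU) ip_suml.
by apply: eq_bigr => i _; rewrite ipZl (ip_sym ip y).
Qed.

(** Induction on the dimension: a unit vector of [U] together with an orthonormal
    basis of its orthogonal complement in [U]. *)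
Lemma onb_exists U : exists n (b : 'I_n -> V), onb U b.
Proof.
have [n] := ubnP (\dim U); elim: n U => // n IHn U Un.
have [->|U0] := eqVneq U 0%VS.
  exists 0%N, (fun=> 0); split => [[]//|[]//|x].
  by rewrite memv0 => /eqP ->; rewrite big_ord0.
pose w := vpick U; have w0 : w != 0 by rewrite vpick0.
have wU : w \in U by exact: memv_pick.
pose v := (Num.sqrt (p w w))^-1 *: w.
have vU : v \in U by rewrite memvZ.
have vv : p v v = 1.
  rewrite ipZl ipZr mulrA -invfM -expr2 sqr_sqrtr ?ip_ge0 // mulVf //.
  by rewrite ip_eq0.
have [g gE] := to_linear (ip_linear ip v).
pose U' := (U :&: lker (linfun g))%VS.
have U'E x : (x \in U') = (x \in U) && (p x v == 0).
  by rewrite memv_cap memv_ker lfunE /= gE.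
have [|m [b ob]] := IHn U'.
  have UU' : (U' <= U)%VS by exact: capvSl.
  rewrite -ltnS; apply: leq_trans Un; rewrite ltnS ltn_neqAle dimvS // andbT.
  apply/negP => /eqP E; have /eqP UE : U' == U by rewrite eqEdim UU' E leqnn.
  by move: vU; rewrite -UE U'E vv oner_eq0 andbF.
have bU i : b i \in U by have := onb_mem ob i; rewrite U'E => /andP[].
have bv i : p (b i) v = 0 by have := onb_mem ob i; rewrite U'E => /andP[_ /eqP].
exists m.+1, (fun i => if unlift ord0 i is Some j then b j else v); split.
- by move=> i; case: unliftP.
- move=> i j; case: unliftP => [i' ->|->]; case: unliftP => [j' ->|->].
  + by rewrite (onb_dot ob) (inj_eq lift_inj).
  + by rewrite bv eq_sym (negbTE (neq_lift _ _)).
  + by rewrite (ip_sym ip) bv (negbTE (neq_lift _ _)).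
  + by rewrite vv eqxx.
- move=> x xU; rewrite big_ord_recl unlift_none.
  under eq_bigr => i _ do rewrite liftK.
  pose y := x - p x v *: v.
  have yU' : y \in U'.
    rewrite U'E rpredB ?rpredZ //= ipDl ipNl ipZl vv mulr1 subrr eqxx //.
  have := onb_expand ob yU'.
  have pyE i : p y (b i) = p x (b i).
    by rewrite ipDl ipNl ipZl (ip_sym ip v) bv mulr0 subr0.
  under [X in _ = X -> _]eq_bigr => i _ do rewrite pyE.
  by move=> <-; rewrite addrC subrK.
Qed.

(** The trace is computed in any orthonormal basis. *)
Lemma trace_onb U (I : finType) (b : I -> V) (f : V -> V) : onb U b ->
  linear f -> (forall x, x \in U -> f x \in U) ->
  \sum_(i < \dim U) coord (vbasis U) i (f (vbasis U)`_i) = \sum_i p (f (b i)) (b i).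
Proof.
move=> ob /to_linear [g <-] fU.
have eU j : (vbasis U)`_j \in U.
  have [jU|jU] := ltnP j (\dim U); last by rewrite nth_default ?size_tuple // mem0v.
  by apply: vbasis_mem; rewrite mem_nth // size_tuple.
under [RHS]eq_bigr => i _ do
  rewrite [X in p X _](coord_vbasis (fU _ (onb_mem ob i))) ip_suml.
rewrite exchange_big; apply: eq_bigr => j _ /=.
under eq_bigr => i _ do rewrite ipZl mulrC.
rewrite [in LHS](onb_expand ob (eU j)) linear_sum linear_sum.
by apply: eq_bigr => i _; rewrite linearZ linearZ.
Qed.

Lemma onb_card U (I : finType) (b : I -> V) : onb U b -> #|I| = \dim U.
Proof.
move=> ob; apply/eqP; rewrite -(eqr_nat R); apply/eqP.
have := trace_onb ob (f := fun x => x) (fun _ _ _ => erefl) (fun _ h => h).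
under [RHS]eq_bigr => i _ do rewrite (onb_dot ob) eqxx.
rewrite sumr_const cardT -cardE => <-.
under eq_bigr => i _.
  rewrite coord_free ?eqxx; last exact: basis_free (vbasisP U).
  over.
by rewrite sumr_const card_ord.
Qed.

(** The trace of a bilinear form does not depend on the orthonormal basis. *)
Lemma trace_form_onb U (I J : finType) (b : I -> V) (c : J -> V) (B : V -> V -> R) :
  (forall y, linear (B^~ y : V -> R^o)) -> (forall x, linear (B x : V -> R^o)) ->
  onb U b -> onb U c -> \sum_i B (b i) (b i) = \sum_j B (c j) (c j).
Proof.
move=> Bl Br ob oc.
have Bsuml (K : finType) (k : K -> R) (u : K -> V) y :
    B (\sum_i k i *: u i) y = \sum_i k i * B (u i) y.
  have [g gE] := to_linear (Bl y); have E x : B x y = g x by rewrite gE.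
  by rewrite E linear_sum; apply: eq_bigr => i _; rewrite linearZ E.
have Bsumr (K : finType) (k : K -> R) (u : K -> V) y :
    B y (\sum_i k i *: u i) = \sum_i k i * B y (u i).
  have [g gE] := to_linear (Br y); have E x : B y x = g x by rewrite gE.
  by rewrite E linear_sum; apply: eq_bigr => i _; rewrite linearZ E.
under eq_bigr => i _ do
  rewrite [X in B X _](onb_expand oc (onb_mem ob i)) Bsuml.
rewrite exchange_big; apply: eq_bigr => j _ /=.
rewrite [X in _ = B _ X](onb_expand ob (onb_mem oc j)) Bsumr.
by apply: eq_bigr => i _; rewrite (ip_sym ip).
Qed.

Lemma onb_cat U (W : {vspace V}) (I J : finType) (b : I -> V) (c : J -> V) :
  (forall x y, x \in U -> y \in W -> p x y = 0) -> onb U b -> onb W c ->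
  onb (U + W)%VS (fun s : I + J => match s with inl i => b i | inr j => c j end).
Proof.
move=> UW ob oc; split.
- case=> [i|j]; first exact: subvP (addvSl _ _) _ (onb_mem ob i).
  exact: subvP (addvSr _ _) _ (onb_mem oc j).
- case=> [i|i] [j|j].
  + by rewrite (onb_dot ob).
  + by rewrite UW // ?(onb_mem ob) ?(onb_mem oc).
  + by rewrite (ip_sym ip) UW // ?(onb_mem ob) ?(onb_mem oc).
  + by rewrite (onb_dot oc).
- move=> _ /memv_addP [u uU [w wW ->]]; rewrite big_sumType /=.
  rewrite [u in LHS](onb_expand ob uU) [w in LHS](onb_expand oc wW).
  congr (_ + _); apply: eq_bigr => i _; rewrite ipDl.
  + by rewrite [p w _](ip_sym ip) (UW (b i) w (onb_mem ob i) wW) addr0.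
  + by rewrite (UW u (c i) uU (onb_mem oc i)) add0r.
Qed.

End theory.
End inner_product.

(** A symmetric bilinear form has an eigenvector with respect to an inner
    product: a maximum point of the form on the unit sphere. *)
Lemma symmetric_form_eigenvector (R : realType) (V : vectType R)
    (p B : V -> V -> R) (U : {vspace V}) :
  inner_product p -> (forall y, linear (B^~ y : V -> R^o)) ->
  (forall x y, B x y = B y x) -> U != 0%VS ->
  exists mu v, [/\ v \in U, v != 0 & forall w, w \in U -> B v w = mu * p v w].
Proof.
move=> ip Bl Bsym U0; have [n [b ob]] := onb_exists ip U.
have BDl x y z : B (x + y) z = B x z + B y z.
  by have := Bl z 1 x y; rewrite !scale1r.
have B0 z : B 0 z = 0.
  by have := BDl 0 0 z; rewrite addr0 => /(congr1 (fun t => t - B 0 z));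
    rewrite subrr addrK.
have BZl c x z : B (c *: x) z = c * B x z.
  by have := Bl z c x 0; rewrite !addr0 B0 addr0.
have BDr x y z : B z (x + y) = B z x + B z y by rewrite !(Bsym z) BDl.
have BZr c x z : B z (c *: x) = c * B z x by rewrite !(Bsym z) BZl.
have Bsuml (k : 'I_n -> R) y : B (\sum_i k i *: b i) y = \sum_i k i * B (b i) y.
  by elim/big_rec2: _ => [|i u v _ <-]; rewrite ?B0 // BDl BZl.
pose vec (x : 'rV[R]_n) := \sum_i x 0 i *: b i.
have vecU x : vec x \in U.
  by apply: memv_suml => i _; apply: memvZ; exact: onb_mem ob i.
have pvec x y : p (vec x) (vec y) = \sum_i x 0 i * y 0 i.
  rewrite (ip_suml ip); apply: eq_bigr => i _; rewrite (ipZl ip) (ip_sumr ip).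
  rewrite (bigD1 i) //= (ipZr ip) (onb_dot ob) eqxx mulr1 big1 ?addr0 // => j ji.
  by rewrite (ipZr ip) (onb_dot ob) eq_sym (negbTE ji) mulr0.
pose S := [set x : 'rV[R]_n | \sum_i x 0 i * x 0 i = 1].
have coordc i : continuous (fun x : 'rV[R]_n => x 0 i) by exact: coord_continuous.
have sumc (F : 'I_n -> 'rV[R]_n -> R) : (forall i, continuous (F i)) ->
    continuous (fun x => \sum_i F i x).
  move=> Fc; have -> : (fun x => \sum_i F i x) = \sum_i F i.
    by apply/funext => x; rewrite fct_sumE.
  elim/big_ind: _ => [|f g fc gc|//].
  - by move=> x; apply: (@cst_continuous _ _ 0).
  - by move=> x; apply: continuousD; [exact: (fc x)|exact: (gc x)].
have Sc : compact S.
  apply: bounded_closed_compact.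
    exists 1; split => // M M1 x Sx; rewrite /Num.Def.normr/= mx_normrE.
    apply: bigmax_le => [|[i j] _]; first by rewrite ltW // (lt_trans ltr01).
    rewrite ord1 /= (le_trans _ (ltW M1)) //.
    rewrite -(@ler_pXn2r _ 2) ?nnegrE // expr1n real_normK ?num_real //.
    rewrite -Sx (bigD1 j) //= expr2 lerDl sumr_ge0 // => l _.
    by rewrite -expr2 sqr_ge0.
  have -> : S = (fun x : 'rV[R]_n => \sum_i x 0 i * x 0 i) @^-1` [set 1] by [].
  apply: closed_comp; last exact: closed_eq.
  move=> x _; apply: (sumc (fun i (x : 'rV[R]_n) => x 0 i * x 0 i)) => i {}x.
  by apply: continuousM; exact: coordc.
pose F (x : 'rV[R]_n) := \sum_i \sum_j (x 0 i * x 0 j) * B (b i) (b j).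
have Fc : continuous F.
  apply: (sumc (fun i (x : 'rV[R]_n) => \sum_j (x 0 i * x 0 j) * B (b i) (b j))) => i.
  apply: (sumc (fun j (x : 'rV[R]_n) => (x 0 i * x 0 j) * B (b i) (b j))) => j x.
  have c : {for x, continuous (fun x : 'rV[R]_n => x 0 i * x 0 j)}.
    by apply: continuousM; exact: coordc.
  by apply: (continuousM c); exact: cst_continuous.
have FE x : B (vec x) (vec x) = F x.
  rewrite Bsuml; apply: eq_bigr => i _; rewrite Bsym Bsuml mulr_sumr.
  by apply: eq_bigr => j _; rewrite mulrA Bsym.
have coords u : u \in U -> exists x, u = vec x.
  move=> uU; exists (\row_i p u (b i)); rewrite [LHS](onb_expand ob uU).
  by apply: eq_bigr => i _; rewrite mxE.
have S0 : S !=set0.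
  have w0 : vpick U != 0 by rewrite vpick0.
  have [x wx] := coords _ (memv_pick U).
  pose c := (Num.sqrt (p (vpick U) (vpick U)))^-1.
  exists (c *: x); rewrite /S /=.
  have : p (c *: vpick U) (c *: vpick U) = 1.
    rewrite (ipZl ip) (ipZr ip) mulrA -invfM -expr2 sqr_sqrtr ?(ip_ge0 ip) // mulVf //.
    by rewrite (ip_eq0 ip).
  move=> <-; rewrite (ipZl ip) (ipZr ip) [in RHS]wx pvec !mulr_sumr.
  by apply: eq_bigr => i _; rewrite !mxE; ring.
have [x Sx xmax] := EVT_max_rV S0 Sc (continuous_subspaceT Fc).
have {}Sx : p (vec x) (vec x) = 1 by rewrite pvec; exact: set_mem Sx.
pose mu := F x.
(* rescaling [w] to the unit sphere *)
have Bmu w : w \in U -> B w w <= mu * p w w.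
  move=> wU; have [->|w0] := eqVneq w 0; first by rewrite B0 (ip0l ip) mulr0.
  have [y wy] := coords _ wU; pose c := (Num.sqrt (p w w))^-1.
  have ccp : c * (c * p w w) = 1.
    rewrite mulrA -invfM -expr2 sqr_sqrtr ?(ip_ge0 ip) // mulVf //.
    by rewrite (ip_eq0 ip).
  have : F (c *: y) <= mu.
    apply: xmax; apply: mem_set; rewrite /S /= -ccp [in RHS]wy pvec !mulr_sumr.
    by apply: eq_bigr => i _; rewrite !mxE; ring.
  have -> : F (c *: y) = c * c * B w w.
    rewrite wy FE mulr_sumr; apply: eq_bigr => i _; rewrite mulr_sumr.
    by apply: eq_bigr => j _; rewrite !mxE; ring.
  have p0 := ip_pos ip w0; move: ccp; rewrite mulrA => ccp le.
  rewrite -(ler_pM2l (_ : 0 < c * c)); last first.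
    by rewrite -(pmulr_lgt0 _ p0) ccp ltr01.
  by rewrite mulrCA ccp mulr1.
have xU := vecU x.
exists mu, (vec x); split => //.
  by apply/negP => /eqP E; move: Sx; rewrite E (ip0l ip) => /eqP; rewrite eq_sym oner_eq0.
(* the form [mu p - B] is nonnegative on [U] and vanishes at the maximum *)
move=> w wU; apply/eqP; rewrite -subr_eq0; apply/eqP.
set d := _ - _.
have key t : 2 * t * d <= t * t * (mu * p w w - B w w).
  have := Bmu (vec x + t *: w) (rpredD xU (rpredZ t wU)).
  rewrite !BDl !BDr !BZl !BZr !(ipDl ip) !(ipDr ip) !(ipZl ip) !(ipZr ip).
  rewrite (Bsym w) (ip_sym ip w) Sx FE -/mu /d; lra.
set q := mu * p w w - B w w in key.
have q0 : 0 <= q by rewrite subr_ge0; exact: Bmu.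
have := key (d / (q + 1)).
have q1 : 0 < q + 1 by rewrite ltr_wpDl.
have -> : 2 * (d / (q + 1)) * d = (d / (q + 1)) ^+ 2 * (2 * (q + 1)).
  by field; rewrite gt_eqF.
rewrite -expr2 -subr_ge0 -mulrBr => le.
have s0 : (d / (q + 1)) ^+ 2 = 0.
  apply/eqP; rewrite eq_le sqr_ge0 andbT.
  have := sqr_ge0 (d / (q + 1)); nra.
by move/eqP: s0; rewrite expf_eq0 /= mulf_eq0 invr_eq0 (gt_eqF q1) orbF => /eqP.
Qed.

(** * Invariant forms of bounded matrix groups *)

Lemma cvg_bigsum (R : realType) (T : Type) (F : set_system T) {FF : Filter F}
    (I : Type) (r : seq I) (f : I -> T -> R) (l : I -> R) :
  (forall i, f i t @[t --> F] --> l i) ->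
  \sum_(i <- r) f i t @[t --> F] --> \sum_(i <- r) l i.
Proof.
move=> fl; elim: r => [|i r IH].
  by under eq_fun do rewrite big_nil; rewrite big_nil; exact: cvg_cst.
by under eq_fun do rewrite big_cons; rewrite big_cons; exact: cvgD (fl i) IH.
Qed.

(** The squared Frobenius norm of a matrix. *)
Definition frob (R : realType) m n (M : 'M[R]_(m, n)) : R := \sum_i \sum_j M i j ^+ 2.

Section frob.
Context {R : realType} {m n : nat}.
Implicit Types M N : 'M[R]_(m, n).

Lemma frob_ge0 M : 0 <= frob M.
Proof. by apply: sumr_ge0 => i _; apply: sumr_ge0 => j _; exact: sqr_ge0. Qed.

Lemma frob_entry M i j : M i j ^+ 2 <= frob M.
Proof.
rewrite /frob (bigD1 i) //= (bigD1 j) //= -addrA lerDl addr_ge0 //.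
  by apply: sumr_ge0 => ? _; exact: sqr_ge0.
by apply: sumr_ge0 => ? _; apply: sumr_ge0 => ? _; exact: sqr_ge0.
Qed.

Lemma frob_eq0 M : frob M <= 0 -> M = 0.
Proof.
move=> M0; apply/matrixP => i j; rewrite mxE; apply/eqP.
by rewrite -sqrf_eq0 eq_le sqr_ge0 andbT (le_trans (frob_entry M i j)).
Qed.

Lemma frob_parallelogram M N :
  frob (2^-1 *: (M + N)) = 2^-1 * frob M + 2^-1 * frob N - 4^-1 * frob (M - N).
Proof.
rewrite /frob !mulr_sumr -big_split -sumrB; apply: eq_bigr => i _ /=.
rewrite !mulr_sumr -big_split -sumrB; apply: eq_bigr => j _ /=.
by rewrite !mxE; field.
Qed.

Lemma frob_le M (b : R) : (forall i j, `|M i j| <= b) -> frob M <= (m * n)%:R * b ^+ 2.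
Proof.
move=> Mb; have -> : (m * n)%:R * b ^+ 2 = \sum_(i < m) \sum_(j < n) b ^+ 2.
  by rewrite !sumr_const !card_ord -mulrnA mulr_natl mulnC.
apply: ler_sum => i _; apply: ler_sum => j _.
by rewrite -[M i j ^+ 2]real_normK ?num_real // lerXn2r // nnegrE (le_trans _ (Mb i j)).
Qed.

Lemma mx_entry_le_sqrt_frob M i j : `|M i j| <= Num.sqrt (frob M).
Proof. by rewrite -sqrtr_sqr ler_sqrt ?frob_ge0 // frob_entry. Qed.

Lemma mx_norm_le M (b : R) : 0 <= b -> (forall i j, `|M i j| <= b) -> `|M| <= b.
Proof.
move=> b0 Mb; rewrite /Num.Def.normr/= mx_normrE.
by apply: bigmax_le => // -[i j] _ /=; exact: Mb.
Qed.

End frob.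

Lemma mulmx_entry_le (R : realType) m n p (M : 'M[R]_(m, n)) (N : 'M[R]_(n, p)) a b :
  (forall i j, `|M i j| <= a) -> (forall i j, `|N i j| <= b) ->
  forall i j, `|(M *m N) i j| <= n%:R * (a * b).
Proof.
move=> Ma Nb i j; rewrite mxE; apply: le_trans (ler_norm_sum _ _ _) _.
have -> : n%:R * (a * b) = \sum_(k < n) (a * b).
  by rewrite sumr_const card_ord mulr_natl.
by apply: ler_sum => k _; rewrite normrM ler_pM.
Qed.

(** A bounded group [A] of matrices, given by a family closed under products and
    inverses, acts on forms by [P |-> A g P (A g)^T].  An invariant form is found by
    minimizing the norm [sup_g |act g P|] over a closed convex invariant set [C] of
    symmetric forms bounded below.  Boundedness makes this invariant norm uniformly
    convex enough for the parallelogram identity to show that minimizing sequences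
    converge and that the minimizer is unique, hence invariant. *)
Section fixed_point.
Context {R : realType} {d : nat} {I : Type}.
Variable A : I -> 'M[R]_d.
Hypothesis A1 : exists g, A g = 1%:M.
Hypothesis AM : forall g h, exists k, A k = A g *m A h.
Hypothesis AV : forall g, exists h, A h *m A g = 1%:M.
Variable b : R.
Hypothesis Ab : forall g i j, `|A g i j| <= b.

Let act g (P : 'M[R]_d) := A g *m P *m (A g)^T.

Let actM g h : exists k, forall P, act k P = act g (act h P).
Proof.
have [k kE] := AM g h; exists k => P.
by rewrite /act kE trmx_mul !mulmxA.
Qed.

Let actV g : exists h, forall P, act h (act g P) = P.
Proof.
have [h hE] := AV g; exists h => P.
rewrite /act !mulmxA hE mul1mx -mulmxA -trmx_mul hE trmx1 mulmx1 //.
Qed.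

Let act_linear g : linear (act g).
Proof. by move=> a P Q; rewrite /act mulmxDr mulmxDl -scalemxAr -scalemxAl. Qed.

Let actD g P Q : act g (P + Q) = act g P + act g Q.
Proof. by have := act_linear g 1 P Q; rewrite !scale1r. Qed.

Let actB g P Q : act g (P - Q) = act g P - act g Q.
Proof. by rewrite -[- Q]scaleN1r addrC act_linear scaleN1r addrC. Qed.

Let act0 g : act g 0 = 0.
Proof. by rewrite /act mulmx0 mul0mx. Qed.

Let actZ g a P : act g (a *: P) = a *: act g P.
Proof. by have := act_linear g a P 0; rewrite act0 !addr0. Qed.

Let bound_exists : exists2 c : R, 0 < c & forall g P, frob (act g P) <= c * frob P.
Proof.
pose e : R := (d * d)%:R * (d%:R * (d%:R * (b * 1) * b)) ^+ 2.
have e0 : 0 <= e by rewrite mulr_ge0 ?sqr_ge0.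
exists (e + 1) => [|g P]; first by rewrite ltr_wpDl.
apply: (@le_trans _ _ (e * frob P)); last by rewrite ler_wpM2r ?frob_ge0 // lerDl.
have -> : e * frob P =
    (d * d)%:R * (d%:R * (d%:R * (b * Num.sqrt (frob P)) * b)) ^+ 2.
  rewrite -[X in _ * X = _](@sqr_sqrtr _ (frob P)) ?frob_ge0 // /e; ring.
apply: frob_le; apply: mulmx_entry_le.
  by apply: mulmx_entry_le; [exact: Ab|exact: mx_entry_le_sqrt_frob].
by move=> i j; rewrite mxE.
Qed.

Let vbound_exists : exists2 c : R, 0 < c &
  forall g (v : 'rV[R]_d), frob (v *m A g) <= c * frob v.
Proof.
pose e : R := (1 * d)%:R * (d%:R * (1 * b)) ^+ 2.
have e0 : 0 <= e by rewrite mulr_ge0 ?sqr_ge0.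
exists (e + 1) => [|g v]; first by rewrite ltr_wpDl.
apply: (@le_trans _ _ (e * frob v)); last by rewrite ler_wpM2r ?frob_ge0 // lerDl.
have -> : e * frob v = (1 * d)%:R * (d%:R * (Num.sqrt (frob v) * b)) ^+ 2.
  rewrite -[X in _ * X = _](@sqr_sqrtr _ (frob v)) ?frob_ge0 // /e; ring.
by apply: frob_le; apply: mulmx_entry_le; [exact: mx_entry_le_sqrt_frob|exact: Ab].
Qed.

Let form (P : 'M[R]_d) (v : 'rV[R]_d) : R := (v *m P *m v^T) 0 0.

Let form_linear v : linear (form^~ v : 'M[R]_d -> R^o).
Proof.
by move=> a P Q; rewrite /form mulmxDr mulmxDl -scalemxAr -scalemxAl !mxE.
Qed.

Let form1 v : form 1%:M v = frob v.
Proof.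
rewrite /form mulmx1 mxE /frob big_ord1; apply: eq_bigr => i _.
by rewrite mxE expr2.
Qed.

Let form_act g P v : form (act g P) v = form P (v *m A g).
Proof. by rewrite /form /act trmx_mul !mulmxA. Qed.

(** A bounded matrix group preserves a positive definite symmetric form. *)
Theorem invariant_form_exists : exists P : 'M[R]_d,
  [/\ P^T = P, forall v : 'rV[R]_d, v != 0 -> 0 < (v *m P *m v^T) 0 0 &
      forall g, A g *m P *m (A g)^T = P].
Proof.
have [c c0 cP] := bound_exists; have [c' c'0 c'P] := vbound_exists.
pose delta := c'^-1; have delta0 : 0 < delta by rewrite invr_gt0.
pose C P := P^T = P /\ forall g v, delta * frob v <= form (act g P) v.
have C1 : C 1%:M.
  split=> [|g v]; first exact: trmx1.
  rewrite form_act form1 ler_pdivrMl //.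
  have [h hE] := AV g; have [h' h'E] := AV h.
  have gh : A g *m A h = 1%:M by exact: mulmx1C.
  by have := c'P h (v *m A g); rewrite -mulmxA gh mulmx1.
have Cmid P Q : C P -> C Q -> C (2^-1 *: (P + Q)).
  move=> [Ps Pp] [Qs Qp]; split=> [|g v].
    by rewrite linearZ /= linearD /= Ps Qs.
  have fE : form (act g (2^-1 *: (P + Q))) v =
      2^-1 * form (act g P) v + 2^-1 * form (act g Q) v.
    have [f fE] := to_linear (form_linear v).
    have E M : form M v = f M by rewrite fE.
    by rewrite !E actZ actD linearZ linearD -mulrDr.
  have := Pp g v; have := Qp g v; rewrite fE; lra.
have Cact h P : C P -> C (act h P).
  move=> [Ps Pp]; split=> [|g v]; first by rewrite /act !trmx_mul trmxK Ps mulmxA.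
  by have [k <-] := actM g h; exact: Pp.
(* [S] is the set of the upper bounds of the squared invariant norms of members
   of [C], so that [mu] is the infimum of these squared norms *)
pose S := [set r : R | exists2 P, C P & forall g, frob (act g P) <= r].
have S0 : S !=set0 by exists (c * frob (1%:M : 'M[R]_d)); exists 1%:M.
have Slb : has_lbound S.
  have [g1 _] := A1.
  by exists 0 => r [P _ Pr]; exact: le_trans (frob_ge0 _) (Pr g1).
pose mu := inf S.
have mu_le r : S r -> mu <= r by move=> Sr; exact: ge_inf.
(* the midpoint of [P] and [Q] lies in [C], so its squared norm is at least [mu] *)
have key P Q r s : C P -> C Q -> (forall g, frob (act g P) <= r) ->
    (forall g, frob (act g Q) <= s) -> frob (P - Q) <= 4 * c * (2^-1 * r + 2^-1 * s - mu).
  move=> CP CQ Pr Qs.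
  have /mu_le : S (2^-1 * r + 2^-1 * s - 4^-1 * (c^-1 * frob (P - Q))).
    exists (2^-1 *: (P + Q)); first exact: Cmid.
    move=> g; rewrite actZ actD frob_parallelogram -actB.
    have [h hE] := actV g.
    have : c^-1 * frob (P - Q) <= frob (act g (P - Q)).
      by rewrite ler_pdivrMl // -{1}(hE (P - Q)).
    by have := Pr g; have := Qs g; lra.
  move=> le; rewrite -mulrA mulrCA -ler_pdivrMl //; lra.
have pick n : exists P, C P /\ forall g, frob (act g P) <= mu + n.+1%:R^-1.
  have [|r [P CP Pr] rlt] := @inf_adherent _ S n.+1%:R^-1 _ (conj S0 Slb).
    by rewrite invr_gt0.
  by exists P; split => // g; apply: le_trans (Pr g) (ltW rlt).
have [u uP] := choice pick.
have ucvg : cvg (u @ \oo).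
  apply: cauchy_cvg; apply: cauchy_exP => e e0.
  pose e' := e / 2; have e'0 : 0 < e' by rewrite divr_gt0.
  have [N _ HN] : \forall n \near \oo, 4 * c * n.+1%:R^-1 <= e' ^+ 2 :> R.
    have t0 : 0 < e' ^+ 2 / (4 * c) by rewrite divr_gt0 ?exprn_gt0 ?mulr_gt0.
    have := @cvg_harmonic R => /cvgrPdist_le /(_ _ t0); apply: filterS => n.
    rewrite sub0r normrN ger0_norm ?invr_ge0 // ler_pdivlMr ?mulr_gt0 //.
    by rewrite mulrC.
  exists (u N); exists N => // n /= Nn; rewrite -ball_normE /=.
  apply: (@le_lt_trans _ _ e'); last by rewrite /e' ltr_pdivrMr // ltr_pMr // ltr1n.
  apply: mx_norm_le => [|i j]; first exact: ltW.
  rewrite -(@ler_pXn2r _ 2) ?nnegrE ?(ltW e'0) // real_normK ?num_real //.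
  apply: le_trans (frob_entry _ i j) _.
  have [CN uN] := uP N; have [Cn un] := uP n.
  apply: le_trans (key _ _ _ _ CN Cn uN un) _.
  apply: le_trans (HN N (leqnn N)).
  have le_nN : n.+1%:R^-1 <= N.+1%:R^-1 :> R by rewrite lef_pV2 ?posrE // ler_nat ltnS.
  apply: ler_wpM2l; first by rewrite mulr_ge0 // ltW.
  move: le_nN; set x := n.+1%:R^-1; set y := N.+1%:R^-1; lra.
pose P := lim (u @ \oo).
have uc : u n @[n --> \oo] --> P := ucvg.
have linc (W : normedModType R) (f : 'M[R]_d -> W) : linear f -> f (u n) @[n --> \oo] --> f P.
  move=> /to_linear [g <-]; apply: continuous_cvg => //.
  exact: mx_linear_continuous.
have CP : C P.
  split=> [|g v].
    have tl : linear (fun M : 'M[R]_d => M^T - M).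
      by move=> a M N; rewrite linearP scalerBr opprD addrACA.
    apply/eqP; rewrite -subr_eq0; apply/eqP.
    have := linc _ _ tl.
    have -> : (fun n => (u n)^T - u n) = cst 0.
      by apply/funext => n; rewrite (uP n).1.1 subrr.
    by move=> h; apply: (cvg_unique _ h (cvg_cst _)).
  have fl : linear (fun M => form (act g M) v : R^o).
    by move=> a M N; rewrite act_linear form_linear.
  have := linc _ _ fl => h.
  apply: (ler_cvg_to (cvg_cst _) h); apply: nearW => n; exact: (uP n).1.2.
have Pmu g : frob (act g P) <= mu.
  have h1 : frob (act g (u n)) @[n --> \oo] --> frob (act g P).
    rewrite /frob; apply: cvg_bigsum => i; apply: cvg_bigsum => j.
    have el : linear (fun M => act g M i j : R^o).
      by move=> a M N; rewrite act_linear !mxE.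
    have hl := linc _ _ el; rewrite expr2.
    under eq_fun do rewrite expr2.
    exact: (cvgM hl hl).
  have h2 : (mu + n.+1%:R^-1 : R) @[n --> \oo] --> mu.
    rewrite -[X in _ --> X]addr0; apply: cvgD; first exact: cvg_cst.
    exact: cvg_harmonic.
  by apply: (ler_cvg_to h1 h2); apply: nearW => n; exact: (uP n).2.
exists P; split.
- exact: CP.1.
- move=> v v0; have [g1 g1E] := A1.
  have := CP.2 g1 v; rewrite form_act g1E mulmx1; apply: lt_le_trans.
  rewrite mulr_gt0 // lt_neqAle frob_ge0 andbT eq_sym.
  by apply: contra v0 => /eqP v0; apply/eqP; apply: frob_eq0; rewrite v0.
- move=> h; apply/eqP; rewrite eq_sym -subr_eq0; apply/eqP/frob_eq0.
  have Phmu g : frob (act g (act h P)) <= mu by have [k <-] := actM g h.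
  apply: le_trans (key _ _ _ _ CP (Cact h P CP) Pmu Phmu) _.
  have -> : 2^-1 * mu + 2^-1 * mu - mu = 0 by field.
  by rewrite mulr0.
Qed.

End fixed_point.

(** * Lie algebras and the Killing form *)

(** The axioms of a Lie bracket, with the Jacobi identity in derivation form. *)
Record lie_bracket (R : pzRingType) (V : lmodType R) (br : V -> V -> V) : Prop := {
  lb_linear : forall y, linear (br^~ y);
  lb_anti : forall x y, br x y = - br y x;
  lb_jacobi : forall x y z, br x (br y z) = br (br x y) z + br y (br x z)
}.

Section lie_bracket.
Context {R : realType} {V : vectType R} (br : V -> V -> V).
Hypothesis lb : lie_bracket br.
Implicit Types (x y z w : V).
Local Notation "⟦ x , y ⟧" := (br x y) (format "⟦ x ,  y ⟧").

Lemma brDl x y z : ⟦x + y, z⟧ = ⟦x, z⟧ + ⟦y, z⟧.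
Proof. by have := lb_linear lb z 1 x y; rewrite !scale1r. Qed.

Lemma br0l z : ⟦0, z⟧ = 0.
Proof.
by have := brDl 0 0 z; rewrite addr0 => /(congr1 (fun t => t - ⟦0, z⟧)); rewrite subrr addrK.
Qed.

Lemma brZl c x z : ⟦c *: x, z⟧ = c *: ⟦x, z⟧.
Proof. by have := lb_linear lb z c x 0; rewrite !addr0 br0l addr0. Qed.

Lemma brDr x y z : ⟦x, y + z⟧ = ⟦x, y⟧ + ⟦x, z⟧.
Proof. by rewrite !(lb_anti lb x) brDl opprD. Qed.

Lemma br0r z : ⟦z, 0⟧ = 0.
Proof. by rewrite (lb_anti lb) br0l oppr0. Qed.

Lemma brZr c x z : ⟦z, c *: x⟧ = c *: ⟦z, x⟧.
Proof. by rewrite !(lb_anti lb z) brZl scalerN. Qed.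

Lemma brxx x : ⟦x, x⟧ = 0.
Proof.
have /eqP := lb_anti lb x x; rewrite -addr_eq0 -mulr2n -scaler_nat scaler_eq0.
by rewrite pnatr_eq0 /= => /eqP.
Qed.

Lemma br_linearr x : linear (br x).
Proof. by move=> a y z; rewrite brDr brZr. Qed.

(** The centre is an ideal, so it vanishes when the algebra is simple. *)
Lemma simple_center0 : (exists x y, ⟦x, y⟧ != 0) ->
  (forall W : {vspace V}, (forall x y, y \in W -> ⟦x, y⟧ \in W) -> W = 0%VS \/ W = fullv) ->
  forall x, (forall y, ⟦x, y⟧ = 0) -> x = 0.
Proof.
move=> [x0 [y0 xy0]] simple.
have brE x y : linfun (br x) y = ⟦x, y⟧.
  by have [g gE] := to_linear (br_linearr x); rewrite -gE lfunE.
have [ad adE] : {g : {linear V -> 'End(V)} | (g : V -> _) = fun x => linfun (br x)}.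
  apply: to_linear => a x y; apply/lfunP => z.
  by rewrite add_lfunE scale_lfunE !brE brDl brZl.
pose Z := lker (linfun ad).
have ZE x : x \in Z <-> forall y, ⟦x, y⟧ = 0.
  rewrite memv_ker lfunE /= adE; split=> [/eqP xZ y|xZ].
    by rewrite -brE xZ zero_lfunE.
  by apply/eqP/lfunP => y; rewrite brE zero_lfunE.
have [|Z0|Zf] := simple Z.
- move=> x y /ZE yZ; have -> : ⟦x, y⟧ = 0 by rewrite (lb_anti lb) yZ oppr0.
  exact: mem0v.
- by move=> x /ZE; rewrite Z0 memv0 => /eqP.
- have /ZE h : x0 \in Z by rewrite Zf memvf.
  by rewrite h eqxx in xy0.
Qed.

Section form.
Variable p : V -> V -> R.
Hypothesis ip : inner_product p.

Hypothesis inv : forall x y z, p ⟦x, y⟧ z + p y ⟦x, z⟧ = 0.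

Lemma ip_skew x y z : p ⟦x, y⟧ z = - p y ⟦x, z⟧.
Proof. by apply/eqP; rewrite -addr_eq0 inv. Qed.

(** Minus the Killing form, the trace being computed in the default basis. *)
Definition kform x y : R :=
  - \sum_(i < \dim (fullv : {vspace V}))
      coord (vbasis fullv) i ⟦x, ⟦y, (vbasis fullv)`_i⟧⟧.

(** Minus the trace of [ad x \o ad y] on an [ad]-stable subspace. *)
Lemma ad_trace (U : {vspace V}) (I : finType) (e : I -> V) x y : onb p U e ->
  (forall u, u \in U -> ⟦x, u⟧ \in U) -> (forall u, u \in U -> ⟦y, u⟧ \in U) ->
  - \sum_(i < \dim U) coord (vbasis U) i ⟦x, ⟦y, (vbasis U)`_i⟧⟧ =
  \sum_i p ⟦x, e i⟧ ⟦y, e i⟧.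
Proof.
move=> oe xU yU; rewrite (trace_onb ip oe (f := fun u => ⟦x, ⟦y, u⟧⟧)).
- by rewrite -sumrN; apply: eq_bigr => i _; rewrite ip_skew opprK (ip_sym ip).
- by move=> a u1 u2; rewrite !brDr !brZr.
- by move=> u uU; apply/xU/yU.
Qed.

Lemma kformE (I : finType) (e : I -> V) x y : onb p fullv e ->
  kform x y = \sum_i p ⟦x, e i⟧ ⟦y, e i⟧.
Proof. by move=> oe; apply: ad_trace => // u _; exact: memvf. Qed.

(** [kform x x] is the sum of the squares [p [x, e i] [x, e i]]. *)
Lemma kform_ip : (forall x, (forall y, ⟦x, y⟧ = 0) -> x = 0) -> inner_product kform.
Proof.
move=> center0; have [n [e oe]] := onb_exists ip fullv; split.
- move=> y a x z; rewrite !(kformE _ _ oe) scaler_sumr -big_split.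
  by apply: eq_bigr => i _; rewrite brDl brZl (ipDl ip) (ipZl ip).
- by move=> x y; rewrite !(kformE _ _ oe); apply: eq_bigr => i _; rewrite (ip_sym ip).
- move=> x; rewrite lt_neqAle (kformE _ _ oe) => x0.
  rewrite sumr_ge0 ?andbT; last by move=> i _; exact: ip_ge0.
  apply: contra x0; rewrite eq_sym psumr_eq0; last by move=> i _; exact: ip_ge0.
  move=> /allP xe; apply/eqP/center0 => y.
  have xe0 i : ⟦x, e i⟧ = 0.
    by apply/eqP; rewrite -(ip_eq0 ip); apply: (xe i); rewrite mem_index_enum.
  have [f fE] := to_linear (br_linearr x).
  rewrite (onb_expand oe (memvf y)) -fE linear_sum big1 // => i _.
  by rewrite linearZ /= fE xe0 scaler0.
Qed.

(** Invariance of the Killing form under the adjoint action of the algebra. *)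
Lemma kform_inv x y z : kform ⟦x, y⟧ z + kform y ⟦x, z⟧ = 0.
Proof.
have [n [e oe]] := onb_exists ip fullv; rewrite !(kformE _ _ oe) -big_split /=.
(* the invariance of [p] and the Jacobi identity leave only the two terms below,
   whose sum over the basis vanishes because [s] is skew-symmetric *)
have E i : p ⟦⟦x, y⟧, e i⟧ ⟦z, e i⟧ + p ⟦y, e i⟧ ⟦⟦x, z⟧, e i⟧ =
    - (p ⟦y, ⟦x, e i⟧⟧ ⟦z, e i⟧ + p ⟦y, e i⟧ ⟦z, ⟦x, e i⟧⟧).
  have J u : ⟦⟦x, u⟧, e i⟧ = ⟦x, ⟦u, e i⟧⟧ - ⟦u, ⟦x, e i⟧⟧.
    by rewrite (lb_jacobi lb) addrK.
  by rewrite !J (ipDl ip) (ipDr ip) (ipNl ip) (ipNr ip) ip_skew; ring.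
under eq_bigr => i _ do rewrite E.
rewrite sumrN big_split /=; apply/eqP; rewrite oppr_eq0; apply/eqP.
pose s i j := p ⟦x, e i⟧ (e j).
have sN i j : s i j = - s j i by rewrite /s ip_skew (ip_sym ip).
have xe i : ⟦x, e i⟧ = \sum_j s i j *: e j by rewrite [LHS](onb_expand oe (memvf _)).
have [f fE] := to_linear (br_linearr y); have [g gE] := to_linear (br_linearr z).
have -> : \sum_i p ⟦y, ⟦x, e i⟧⟧ ⟦z, e i⟧ =
    \sum_i \sum_j s i j * p ⟦y, e j⟧ ⟦z, e i⟧.
  apply: eq_bigr => i _; rewrite xe -fE linear_sum (ip_suml ip).
  by apply: eq_bigr => j _; rewrite linearZ (ipZl ip) fE.
have -> : \sum_i p ⟦y, e i⟧ ⟦z, ⟦x, e i⟧⟧ =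
    \sum_i \sum_j s i j * p ⟦y, e i⟧ ⟦z, e j⟧.
  apply: eq_bigr => i _; rewrite xe -gE linear_sum (ip_sumr ip).
  by apply: eq_bigr => j _; rewrite linearZ (ipZr ip) gE.
rewrite [X in _ + X]exchange_big -big_split big1 //= => i _.
by rewrite -big_split big1 //= => j _; rewrite (sN j i) mulNr subrr.
Qed.

(** [kform] is invariant under the automorphisms which preserve [p]. *)
Lemma kform_aut (h h' : V -> V) : linear h -> cancel h' h ->
  (forall x y, h ⟦x, y⟧ = ⟦h x, h y⟧) ->
  (forall x y, p (h x) (h y) = p x y) ->
  forall x y, kform (h x) (h y) = kform x y.
Proof.
move=> hl hK hbr hp x y; have [n [e oe]] := onb_exists ip fullv.
have ohe : onb p fullv (h \o e).
  split => [i|i j|u _]; first exact: memvf.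
    by rewrite /= hp (onb_dot oe).
  rewrite -[u in LHS]hK [h' u in LHS](onb_expand oe (memvf _)).
  have [f fE] := to_linear hl; rewrite -fE linear_sum; apply: eq_bigr => i _.
  by rewrite linearZ /= -{1}(hp (h' u)) hK -fE.
rewrite (kformE _ _ ohe) (kformE _ _ oe); apply: eq_bigr => i _.
by rewrite /= -!hbr hp.
Qed.

End form.
End lie_bracket.

(** * Ricci curvature of the two-parameter metrics *)

(** An abstract Lie algebra with an invariant inner product [Q], equal to minus its
    Killing form, a subalgebra [k] and its orthogonal complement [a]. *)
Section decomposition.
Context {R : realType} {V : vectType R} (br : V -> V -> V) (Q : V -> V -> R).
Implicit Types (x y z u v w : V).
Local Notation "⟦ x , y ⟧" := (br x y) (format "⟦ x ,  y ⟧").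

Hypothesis lb : lie_bracket br.
Hypothesis ip : inner_product Q.
Hypothesis inv : forall x y z, Q ⟦x, y⟧ z + Q y ⟦x, z⟧ = 0.
Hypothesis Qform : forall x y, kform br x y = Q x y.

Variables k a : {vspace V}.
Hypothesis kk : forall x y, x \in k -> y \in k -> ⟦x, y⟧ \in k.
Hypothesis aE : forall x, x \in a <-> forall y, y \in k -> Q x y = 0.

Lemma Qak x y : x \in a -> y \in k -> Q x y = 0.
Proof. by move=> /aE h yk; exact: h. Qed.

Lemma Qka x y : x \in k -> y \in a -> Q x y = 0.
Proof. by move=> xk ya; rewrite (ip_sym ip) Qak. Qed.

(** Two forms of the invariance of [Q], which bring the terms of the Ricci tensor
    to inner products of brackets with [x]. *)
Lemma skewl x y u : Q ⟦y, u⟧ x = Q u ⟦x, y⟧.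
Proof. by rewrite (ip_skew inv) (lb_anti lb) (ipNr ip) opprK. Qed.

Lemma skewr x z u : Q ⟦u, z⟧ x = - Q u ⟦x, z⟧.
Proof. by rewrite (lb_anti lb) (ipNl ip) skewl (lb_anti lb x) (ipNr ip). Qed.

Lemma br_ka x y : x \in k -> y \in a -> ⟦x, y⟧ \in a.
Proof.
move=> xk ya; apply/aE => z zk.
by rewrite (ip_skew inv) Qak ?oppr0 //; exact: kk.
Qed.

Lemma br_ak x y : x \in a -> y \in k -> ⟦x, y⟧ \in a.
Proof. by move=> xa yk; rewrite (lb_anti lb) rpredN br_ka. Qed.

Lemma ak_direct : (a :&: k = 0)%VS.
Proof.
apply/eqP; rewrite -subv0; apply/subvP => x; rewrite memv_cap => /andP[xa xk].
by rewrite memv0 -(ip_eq0 ip) Qak.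
Qed.

Lemma ak_full : (a + k = fullv)%VS.
Proof.
apply/eqP; rewrite eqEsubv subvf /=; apply/subvP => x _.
have [n [f of_]] := onb_exists ip k.
pose v := \sum_i Q x (f i) *: f i.
have vk : v \in k by apply: memv_suml => i _; rewrite memvZ ?(onb_mem of_).
rewrite -[x](subrK v) memv_add //; apply/aE => y yk.
rewrite (ipDl ip) (ipNl ip) (ip_suml ip) [Q x y](ip_sym ip).
apply/eqP; rewrite -(onb_parseval ip x of_ yk) subr_eq0; apply/eqP.
apply: eq_bigr => i _.
by rewrite (ipZl ip) [Q (f i) y](ip_sym ip) mulrC.
Qed.

(** The projections onto [a] and [k]. *)
Definition pa := daddv_pi a k.
Definition pk := daddv_pi k a.

Lemma pa_mem x : pa x \in a. Proof. exact: memv_pi. Qed.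
Lemma pk_mem x : pk x \in k. Proof. exact: memv_pi. Qed.

Lemma paD x y : pa (x + y) = pa x + pa y. Proof. exact: linearD. Qed.
Lemma pkD x y : pk (x + y) = pk x + pk y. Proof. exact: linearD. Qed.
Lemma paZ c x : pa (c *: x) = c *: pa x. Proof. exact: linearZ. Qed.
Lemma pkZ c x : pk (c *: x) = c *: pk x. Proof. exact: linearZ. Qed.

Lemma pa_pk x : pa x + pk x = x.
Proof. by apply: daddv_pi_add; rewrite ?ak_direct // ak_full memvf. Qed.

Lemma pa_id x : x \in a -> pa x = x.
Proof. by move=> xa; exact: daddv_pi_id ak_direct xa. Qed.

Lemma pk_id x : x \in k -> pk x = x.
Proof. by move=> xk; apply: daddv_pi_id xk; rewrite capvC ak_direct. Qed.

Lemma pa0 x : x \in k -> pa x = 0.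
Proof. by move=> xk; apply: (addIr (pk x)); rewrite pa_pk add0r pk_id. Qed.

Lemma pk0 x : x \in a -> pk x = 0.
Proof. by move=> xk; apply: (addrI (pa x)); rewrite pa_pk addr0 pa_id. Qed.

Lemma Qpa x y : x \in a -> Q x (pa y) = Q x y.
Proof. by move=> xa; rewrite -[in RHS](pa_pk y) (ipDr ip) (Qak xa (pk_mem y)) addr0. Qed.

Lemma Qpk x y : x \in k -> Q x (pk y) = Q x y.
Proof. by move=> xk; rewrite -[in RHS](pa_pk y) (ipDr ip) (Qka xk (pa_mem y)) add0r. Qed.

(** Minus the trace of [ad x \o ad y] on [U]; for [U = k], minus the Killing form
    of [k]. *)
Definition kform_on (U : {vspace V}) x y : R :=
  - \sum_(i < \dim U) coord (vbasis U) i ⟦x, ⟦y, (vbasis U)`_i⟧⟧.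

Section bases.
Variables (I J : finType) (e : I -> V) (f : J -> V).
Hypotheses (oe : onb Q a e) (of_ : onb Q k f).

Lemma onb_full : onb Q fullv (fun s : I + J => match s with inl i => e i | inr j => f j end).
Proof. by rewrite -ak_full; apply: onb_cat => // x y; exact: Qak. Qed.

(** The contributions of [a] and of [k] to the trace that defines [Q x y].  On [a],
    [Sk] is the bilinear form of the Casimir operator of [k]. *)
Definition Sa x y := \sum_i Q ⟦e i, x⟧ ⟦e i, y⟧.
Definition Sk x y := \sum_j Q ⟦f j, x⟧ ⟦f j, y⟧.

Lemma SaSk x y : Sa x y + Sk x y = Q x y.
Proof.
rewrite -Qform (kformE lb ip inv _ _ onb_full) big_sumType /=.
by congr (_ + _); apply: eq_bigr => i _;
  rewrite (lb_anti lb x) (lb_anti lb y) (ipNl ip) (ipNr ip) opprK.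
Qed.

Lemma Sk_sym x y : Sk x y = Sk y x.
Proof. by apply: eq_bigr => i _; exact: ip_sym. Qed.

Lemma Sk_linear y : linear (Sk^~ y : V -> R^o).
Proof.
move=> c x z; rewrite /Sk scaler_sumr -big_split; apply: eq_bigr => i _.
by rewrite (brDr lb) (brZr lb) (ipDl ip) (ipZl ip).
Qed.

Lemma Sk_ak x y : x \in a -> y \in k -> Sk x y = 0.
Proof.
move=> xa yk; rewrite /Sk big1 // => j _.
by rewrite Qak //; [apply: br_ka|apply: kk] => //; exact: onb_mem of_ j.
Qed.

Lemma Sk_ka x y : x \in k -> y \in a -> Sk x y = 0.
Proof. by move=> xk ya; rewrite Sk_sym Sk_ak. Qed.

Lemma Sa_ak x y : x \in a -> y \in k -> Sa x y = 0.
Proof. by move=> xa yk; have := SaSk x y; rewrite Sk_ak // addr0 Qak. Qed.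

Lemma Sa_ka x y : x \in k -> y \in a -> Sa x y = 0.
Proof. by move=> xa yk; have := SaSk x y; rewrite Sk_ka // addr0 Qka. Qed.

(** Both sides are the sum of [Q [f j, z] (e i) * Q [f j, y] (e i)] over [i] and
    [j]. *)
Lemma sum_pk y z : y \in a -> z \in a -> \sum_i Q (pk ⟦e i, z⟧) ⟦e i, y⟧ = Sk z y.
Proof.
move=> ya za.
have E i : Q (pk ⟦e i, z⟧) ⟦e i, y⟧ = \sum_j Q ⟦f j, z⟧ (e i) * Q ⟦f j, y⟧ (e i).
  rewrite -(Qpk _ (pk_mem _)) -(onb_parseval ip _ of_ (pk_mem _)).
  apply: eq_bigr => j _.
  have S w : Q ⟦f j, w⟧ (e i) = - Q ⟦e i, w⟧ (f j) by rewrite skewr (ip_sym ip).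
  rewrite !(ip_sym ip (pk _)) !(Qpk _ (onb_mem of_ j)) !(ip_sym ip (f j)) !S.
  by rewrite mulrNN.
under eq_bigr => i _ do rewrite E.
rewrite exchange_big; apply: eq_bigr => j _ /=.
by rewrite (onb_parseval ip _ oe) //; apply: br_ka => //; exact: onb_mem of_ j.
Qed.

(** The metric [alpha Q|a + alpha1 Q|k]. *)
Definition gform (alpha alpha1 : R) x y := alpha * Q (pa x) (pa y) + alpha1 * Q (pk x) (pk y).

Lemma gformE alpha alpha1 x y :
  gform alpha alpha1 x y = alpha * Q (pa x) y + alpha1 * Q (pk x) y.
Proof. by rewrite /gform (Qpa _ (pa_mem x)) (Qpk _ (pk_mem x)). Qed.

Lemma gformC alpha alpha1 x y : gform alpha alpha1 x y = gform alpha alpha1 y x.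
Proof. by rewrite /gform (ip_sym ip (pa x)) (ip_sym ip (pk x)). Qed.

Lemma gform_inj alpha alpha1 x y : 0 < alpha -> 0 < alpha1 ->
  (forall w, gform alpha alpha1 x w = gform alpha alpha1 y w) -> x = y.
Proof.
move=> al al1 xy; apply/eqP; rewrite -subr_eq0; apply/eqP.
set u := x - y.
have : gform alpha alpha1 u u = 0.
  have paB : pa u = pa x - pa y by exact: linearB.
  have pkB : pk u = pk x - pk y by exact: linearB.
  have := xy u; rewrite !gformE paB pkB !(ipDl ip) !(ipNl ip); lra.
rewrite /gform => /eqP; rewrite paddr_eq0 ?mulr_ge0 ?(ip_ge0 ip) ?ltW //.
rewrite !mulf_eq0 (gt_eqF al) (gt_eqF al1) /= !(ip_eq0 ip) => /andP[/eqP ua /eqP uk].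
by rewrite -(pa_pk u) ua uk addr0.
Qed.

(** A group of automorphisms [act], which preserve [Q] and [k] and act irreducibly
    on [a]. *)
Section symmetry.
Variables (H : Type) (act : H -> V -> V).
Hypothesis act_linear : forall h, linear (act h).
Hypothesis act_inv : forall h, exists h', cancel (act h) (act h') /\ cancel (act h') (act h).
Hypothesis act_br : forall h x y, act h ⟦x, y⟧ = ⟦act h x, act h y⟧.
Hypothesis act_Q : forall h x y, Q (act h x) (act h y) = Q x y.
Hypothesis act_k : forall h x, x \in k -> act h x \in k.

Lemma act_a h x : x \in a -> act h x \in a.
Proof.
move=> xa; apply/aE => y yk; have [h' [_ hK]] := act_inv h.
by rewrite -(hK y) act_Q Qak // act_k.
Qed.

Lemma onb_act h : onb Q k (act h \o f).
Proof.
have [h' [hK h'K]] := act_inv h; split=> [j|i j|x xk].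
- by apply: act_k; exact: onb_mem of_ j.
- by rewrite /= act_Q (onb_dot of_).
- rewrite -[x in LHS]h'K [act h' x in LHS](onb_expand of_ (act_k h' xk)).
  have [g gE] := to_linear (act_linear h).
  rewrite -gE linear_sum; apply: eq_bigr => j _.
  by rewrite linearZ /= gE -{1}(act_Q h) h'K.
Qed.

(** [act h] carries an orthonormal basis of [k] to another one. *)
Lemma Sk_act h x y : Sk (act h x) (act h y) = Sk x y.
Proof.
rewrite /Sk (trace_form_onb ip (B := fun u v => Q ⟦u, act h x⟧ ⟦v, act h y⟧) _ _ of_ (onb_act h)).
- by apply: eq_bigr => j _; rewrite /= -!act_br act_Q.
- by move=> v c u1 u2; rewrite (brDl lb) (brZl lb) (ipDl ip) (ipZl ip).
- by move=> v c u1 u2; rewrite (brDl lb) (brZl lb) (ipDr ip) (ipZr ip).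
Qed.

Hypothesis a_neq0 : a <> 0%VS.
Hypothesis act_irreducible : forall W : {vspace V}, (W <= a)%VS ->
  (forall h x, x \in W -> act h x \in W) -> W = 0%VS \/ W = a.

(** Schur's lemma: the Casimir operator of [k] acts on [a] by a scalar, since its
    eigenspaces in [a] are stable under [act]. *)
Lemma casimir_scalar : exists zeta, forall y z, y \in a -> z \in a -> Sk y z = zeta * Q y z.
Proof.
have a0 : a != 0%VS by apply/eqP.
have [mu [v [va v0 vE]]] := symmetric_form_eigenvector ip Sk_linear Sk_sym a0.
exists mu.
(* [W] below is the eigenspace of [mu], as the kernel of [L] in [a] *)
pose L y := \sum_i (Sk y (e i) - mu * Q y (e i)) *: e i.
have Ll : linear L.
  move=> c x y; rewrite /L scaler_sumr -big_split; apply: eq_bigr => i _ /=.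
  by rewrite Sk_linear (ipDl ip) (ipZl ip) scalerA -scalerDl; congr (_ *: _); rewrite /GRing.scale /=; ring.
have [g gE] := to_linear Ll.
pose W := (a :&: lker (linfun g))%VS.
have WE y : y \in W <-> y \in a /\ forall w, w \in a -> Sk y w = mu * Q y w.
  rewrite memv_cap memv_ker lfunE /= gE; split.
    move=> /andP[ya /eqP Ly]; split => // w wa.
    have Li i : Sk y (e i) - mu * Q y (e i) = 0.
      have := congr1 (Q^~ (e i)) Ly; rewrite (ip0l ip) (ip_suml ip) (bigD1 i) //=.
      rewrite (ipZl ip) (onb_dot oe) eqxx mulr1 big1 ?addr0 // => j ji.
      by rewrite (ipZl ip) (onb_dot oe) (negbTE ji) mulr0.
    rewrite (onb_expand oe wa) (ip_sumr ip) mulr_sumr Sk_sym.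
    have [s sE] := to_linear (Sk_linear y); have E u : Sk u y = s u by rewrite sE.
    rewrite E linear_sum; apply: eq_bigr => i _; rewrite linearZ /= -E Sk_sym.
    by move/eqP: (Li i); rewrite subr_eq0 => /eqP ->; rewrite (ipZr ip) /GRing.scale /=; ring.
  move=> [ya yE]; rewrite ya /=; apply/eqP; rewrite /L big1 // => i _.
  by rewrite yE ?subrr ?scale0r //; exact: onb_mem oe i.
have [||W0|Wa] := @act_irreducible W.
- exact: capvSl.
- move=> h x /WE [xa xE]; apply/WE; split=> [|w wa]; first exact: act_a.
  have [h' [_ hK]] := act_inv h.
  by rewrite -(hK w) Sk_act act_Q; apply/xE/act_a.
- have /WE : v \in a /\ forall w, w \in a -> Sk v w = mu * Q v w by [].
  by rewrite W0 memv0 (negbTE v0).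
- by move=> y z ya; apply: ((WE y).1 _).2; rewrite Wa.
Qed.

End symmetry.

(* the Killing form of [k] is [- kappa Q] *)
Variable kappa : R.
Hypothesis kappaE : forall x y, x \in k -> y \in k -> kform_on k x y = kappa * Q x y.

Lemma Sk_kk x y : x \in k -> y \in k -> Sk x y = kappa * Q x y.
Proof.
move=> xk yk; rewrite -kappaE // /kform_on.
rewrite (ad_trace lb ip inv of_) => [|u uk|u uk]; try exact: kk.
by apply: eq_bigr => j _; rewrite (lb_anti lb x) (lb_anti lb y) (ipNl ip) (ipNr ip) opprK.
Qed.

(** Taking the trace over [a] of the Casimir operator. *)
Lemma casimir_trace zeta : (forall y z, y \in a -> z \in a -> Sk y z = zeta * Q y z) ->
  zeta * (\dim a)%:R = (\dim k)%:R * (1 - kappa).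
Proof.
move=> zE; rewrite -(onb_card ip oe) -(onb_card ip of_).
have -> : zeta * #|I|%:R = \sum_i Sk (e i) (e i).
  under eq_bigr => i _.
    rewrite zE ?(onb_mem oe) // (onb_dot oe) eqxx mulr1; over.
  by rewrite sumr_const cardT -cardE mulr_natr.
rewrite exchange_big /=.
have -> : #|J|%:R * (1 - kappa) = \sum_j Sa (f j) (f j).
  under eq_bigr => j _.
    have -> : Sa (f j) (f j) = 1 - kappa.
      have fk := onb_mem of_ j.
      have Q1 : Q (f j) (f j) = 1 by rewrite (onb_dot of_) eqxx.
      by have := SaSk (f j) (f j); rewrite Sk_kk // Q1 mulr1 => <-; rewrite addrK.
    over.
  by rewrite sumr_const cardT -cardE mulr_natl.
apply: eq_bigr => j _; apply: eq_bigr => i _.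
by rewrite (lb_anti lb (f j)) (ipNl ip) (ipNr ip) opprK.
Qed.

Lemma kappa_ge0 : k != 0%VS -> 0 <= kappa.
Proof.
move=> k0; pose v := vpick k; have v0 : v != 0 by rewrite vpick0.
have vk : v \in k := memv_pick k.
rewrite -(pmulr_lge0 _ (ip_pos ip v0)) -Sk_kk //.
by apply: sumr_ge0 => j _; exact: ip_ge0.
Qed.

(** If [kappa = 1], then [k] commutes with [a] and hence is an ideal. *)
Lemma kappa_lt1 : k != 0%VS ->
  (forall W : {vspace V}, (forall x y, y \in W -> ⟦x, y⟧ \in W) -> W = 0%VS \/ W = fullv) ->
  a != 0%VS -> kappa < 1.
Proof.
move=> k0 simple a0.
have Sa_k x : x \in k -> Sa x x = (1 - kappa) * Q x x.
  move=> xk; have := SaSk x x; rewrite Sk_kk // mulrBl mul1r => E.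
  by rewrite -[X in _ = X - _]E addrK.
have Sa_ge0 x : 0 <= Sa x x by apply: sumr_ge0 => i _; exact: ip_ge0.
pose v := vpick k; have v0 : v != 0 by rewrite vpick0.
have vk : v \in k := memv_pick k.
rewrite -subr_gt0 lt_neqAle -(pmulr_lge0 _ (ip_pos ip v0)) -Sa_k // Sa_ge0 andbT.
apply/eqP => kappa1.
have comm x y : x \in a -> y \in k -> ⟦x, y⟧ = 0.
  move=> xa yk; have /eqP := Sa_k y yk; rewrite -kappa1 mul0r.
  rewrite psumr_eq0; last by move=> i _; exact: ip_ge0.
  move=> /allP h; have [g gE] := to_linear (lb_linear lb y).
  have E u : ⟦u, y⟧ = g u by rewrite gE.
  rewrite E (onb_expand oe xa) linear_sum big1 // => i _; rewrite linearZ /= -E.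
  have /eqP -> : ⟦e i, y⟧ == 0.
    by rewrite -(ip_eq0 ip); apply: (h i); rewrite mem_index_enum.
  by rewrite scaler0.
have [|kE|kE] := simple k.
- move=> x y yk; rewrite -(pa_pk x) (brDl lb) (comm _ _ (pa_mem x) yk) add0r.
  by apply: kk => //; exact: pk_mem.
- by rewrite kE eqxx in k0.
- by move: a0; rewrite -subv0 -ak_direct kE capvf subvv.
Qed.

Section curvature.
(* [c] stands for [(1 - alpha1 / alpha) / 2]; see [koszul] *)
Variable c : R.

(** The Levi-Civita connection of [alpha Q|a + alpha1 Q|k], where
    [c = (1 - alpha1 / alpha) / 2]. *)
Definition conn x y := 2^-1 *: ⟦x, y⟧ + c *: (⟦pk x, pa y⟧ - ⟦pa x, pk y⟧).

Lemma connDl x z y : conn (x + z) y = conn x y + conn z y.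
Proof.
rewrite /conn ?paD ?pkD !(brDl lb) opprD [X in c *: X]addrACA !scalerDr.
exact: addrACA.
Qed.

Lemma connDr x y z : conn x (y + z) = conn x y + conn x z.
Proof.
rewrite /conn ?paD ?pkD !(brDr lb) opprD [X in c *: X]addrACA !scalerDr.
exact: addrACA.
Qed.

Lemma connZl t x y : conn (t *: x) y = t *: conn x y.
Proof.
by rewrite /conn ?paZ ?pkZ !(brZl lb) -scalerBr !scalerDr !scalerA !(mulrC t).
Qed.

Lemma connZr t x y : conn x (t *: y) = t *: conn x y.
Proof.
by rewrite /conn ?paZ ?pkZ !(brZr lb) -scalerBr !scalerDr !scalerA !(mulrC t).
Qed.

Lemma conn_aa x y : x \in a -> y \in a -> conn x y = 2^-1 *: ⟦x, y⟧.
Proof.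
by move=> xa ya; rewrite /conn (pk0 xa) (pk0 ya) (br0l lb) (br0r lb) subr0 scaler0 addr0.
Qed.

Lemma conn_kk x y : x \in k -> y \in k -> conn x y = 2^-1 *: ⟦x, y⟧.
Proof.
by move=> xk yk; rewrite /conn (pa0 xk) (pa0 yk) (br0l lb) (br0r lb) subr0 scaler0 addr0.
Qed.

Lemma conn_ka x y : x \in k -> y \in a -> conn x y = (2^-1 + c) *: ⟦x, y⟧.
Proof.
move=> xk ya; rewrite /conn (pk_id xk) (pa_id ya) (pa0 xk) (pk0 ya) (br0l lb) subr0.
by rewrite scalerDl.
Qed.

Lemma conn_ak x y : x \in a -> y \in k -> conn x y = (2^-1 - c) *: ⟦x, y⟧.
Proof.
move=> xa yk; rewrite /conn (pk0 xa) (pa0 yk) (pa_id xa) (pk_id yk) (br0l lb) sub0r.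
by rewrite scalerBl scalerN.
Qed.

(** In the trace that defines the Ricci tensor, [conn x (conn y z)] contributes
    nothing. *)
Lemma conn_diag_a x w : x \in a -> Q (conn x w) x = 0.
Proof.
move=> xa; rewrite /conn (pk0 xa) (pa_id xa) (br0l lb) sub0r scalerN (ipDl ip) (ipNl ip).
by rewrite !(ipZl ip) !(ip_skew inv) (brxx lb) !(ip0r ip) !(oppr0, mulr0, addr0).
Qed.

Lemma conn_diag_k x w : x \in k -> Q (conn x w) x = 0.
Proof.
move=> xk; rewrite /conn (pa0 xk) (pk_id xk) (br0l lb) subr0 (ipDl ip).
by rewrite !(ipZl ip) !(ip_skew inv) (brxx lb) !(ip0r ip) !(oppr0, mulr0, addr0).
Qed.

Lemma subr2ACA (p q r p' q' r' : V) :
  p + p' - (q + q') - (r + r') = p - q - r + (p' - q' - r').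
Proof. by rewrite [RHS]addrACA [X in _ = X + _]addrACA -!opprD. Qed.

(** [conn] satisfies the Koszul formula of the metric. *)
Lemma koszul alpha alpha1 x y w : 0 < alpha -> c = (1 - alpha1 / alpha) / 2 ->
  2 * gform alpha alpha1 (conn x y) w = gform alpha alpha1 ⟦x, y⟧ w
    - gform alpha alpha1 ⟦y, w⟧ x + gform alpha alpha1 ⟦w, x⟧ y.
Proof.
move=> al cE; rewrite (gformC _ _ ⟦y, w⟧) (gformC _ _ ⟦w, x⟧).
have Da : ⟦pk x, pa y⟧ - ⟦pa x, pk y⟧ \in a.
  by apply: rpredB; [exact: (br_ka (pk_mem x) (pa_mem y))|exact: (br_ak (pa_mem x) (pk_mem y))].
rewrite !gformE /conn paD pkD !paZ !pkZ (pa_id Da) (pk0 Da) scaler0 addr0.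
have E1 u v : Q u ⟦y, v⟧ = - Q ⟦y, u⟧ v by rewrite (ip_skew inv) opprK.
have E2 u v : Q u ⟦v, x⟧ = Q ⟦x, u⟧ v.
  by rewrite (ip_skew inv) (lb_anti lb v) (ipNr ip).
rewrite !E1 !E2 !(ipDl ip, ipZl ip, ipNl ip).
have X1 u : ⟦y, u⟧ = ⟦pa y, u⟧ + ⟦pk y, u⟧ by rewrite -(brDl lb) pa_pk.
have X2 u : ⟦x, u⟧ = ⟦pa x, u⟧ + ⟦pk x, u⟧ by rewrite -(brDl lb) pa_pk.
rewrite (X1 (pa x)) (X1 (pk x)) (X2 (pa y)) (X2 (pk y)) !(ipDl ip).
rewrite (lb_anti lb (pa y)) (lb_anti lb (pk y) (pa x)) (lb_anti lb (pa y) (pk x)).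
rewrite (lb_anti lb (pk y) (pk x)) !(ipNl ip) cE; field.
by rewrite gt_eqF.
Qed.

(** The curvature tensor of [conn]. *)
Definition curv x y z := conn x (conn y z) - conn y (conn x z) - conn ⟦x, y⟧ z.

Lemma curv_linear y z : linear (fun x => curv x y z).
Proof.
move=> t x x'; rewrite /curv (brDl lb) (brZl lb).
rewrite (connDl (t *: x) x' (conn y z)) (connZl t x (conn y z)).
rewrite (connDl (t *: x) x' z) (connZl t x z) (connDr y (t *: conn x z)) (connZr t y (conn x z)).
rewrite (connDl (t *: ⟦x, y⟧) ⟦x', y⟧ z) (connZl t ⟦x, y⟧ z).
by rewrite subr2ACA -!scalerBr.
Qed.

(** The trace of [x |-> curv x y z] in the orthonormal basis [e], [f]. *)
Definition ricci y z :=
  \sum_i Q (curv (e i) y z) (e i) + \sum_j Q (curv (f j) y z) (f j).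

Lemma curvDr x y z w : curv x y (z + w) = curv x y z + curv x y w.
Proof. rewrite /curv (connDr y z w) (connDr x z w) (connDr x (conn y z)) (connDr y (conn x z)).
by rewrite (connDr ⟦x, y⟧ z); exact: subr2ACA. Qed.

Lemma curvDm x y z w : curv x (y + z) w = curv x y w + curv x z w.
Proof.
rewrite /curv (brDr lb) (connDl y z w) (connDl y z (conn x w)) (connDr x (conn y w)).
by rewrite (connDl ⟦x, y⟧); exact: subr2ACA.
Qed.

Lemma ip_sub2 (u v w x : V) : Q (u - v - w) x = Q u x - Q v x - Q w x.
Proof. by rewrite !(ipDl ip) !(ipNl ip). Qed.

Lemma curv_diag_a x y z : x \in a ->
  Q (curv x y z) x = - Q (conn y (conn x z)) x - Q (conn ⟦x, y⟧ z) x.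
Proof.
by move=> xa; rewrite /curv ip_sub2 conn_diag_a // add0r.
Qed.

Lemma curv_diag_k x y z : x \in k ->
  Q (curv x y z) x = - Q (conn y (conn x z)) x - Q (conn ⟦x, y⟧ z) x.
Proof.
by move=> xa; rewrite /curv ip_sub2 conn_diag_k // add0r.
Qed.

Local Notation ea i := (onb_mem oe i).
Local Notation fk j := (onb_mem of_ j).

Lemma ricci_kk y z : y \in k -> z \in k ->
  ricci y z = (2^-1 - c) ^+ 2 * Sa y z + 4^-1 * Sk y z.
Proof.
move=> yk zk; rewrite /ricci /Sa /Sk !mulr_sumr; congr (_ + _).
  apply: eq_bigr => i _; have ei := ea i.
  rewrite (curv_diag_a _ _ ei) (conn_ak ei zk) connZr (conn_ka yk (br_ak ei zk)).
  rewrite (conn_ak (br_ak ei yk) zk) !(ipZl ip) (skewl (e i) y) (skewr (e i) z).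
  by rewrite (ip_sym ip ⟦e i, z⟧); field.
apply: eq_bigr => j _; have fj := fk j.
rewrite (curv_diag_k _ _ fj) (conn_kk fj zk) connZr (conn_kk yk (kk fj zk)).
rewrite (conn_kk (kk fj yk) zk) !(ipZl ip) (skewl (f j) y) (skewr (f j) z).
by rewrite (ip_sym ip ⟦f j, z⟧); field.
Qed.

Lemma ricci_ka y z : y \in k -> z \in a -> ricci y z = 0.
Proof.
move=> yk za; rewrite /ricci.
have -> : \sum_i Q (curv (e i) y z) (e i) = (4^-1 - 2^-1 * c) * Sa y z.
  rewrite mulr_sumr; apply: eq_bigr => i _; have ei := ea i.
  rewrite (curv_diag_a _ _ ei) (conn_aa ei za) connZr -[X in conn y X](pa_pk ⟦e i, z⟧).
  rewrite connDr (conn_ka yk (pa_mem _)) (conn_kk yk (pk_mem _)).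
  rewrite (conn_aa (br_ak ei yk) za) !(ipZl ip, ipDl ip) !(skewl (e i) y) (skewr (e i) z).
  rewrite (Qka (pk_mem _) (br_ak ei yk)) (ip_sym ip (pa _)) (Qpa _ (br_ak ei yk)).
  by field.
have -> : \sum_j Q (curv (f j) y z) (f j) = 0.
  rewrite big1 // => j _; have fj := fk j.
  rewrite (curv_diag_k _ _ fj) (conn_ka fj za) connZr (conn_ka yk (br_ka fj za)).
  rewrite (conn_ka (kk fj yk) za) !(ipZl ip) (skewl (f j) y) (skewr (f j) z).
  by rewrite (Qak (br_ka fj za) (kk fj yk)) (Qka (kk fj yk) (br_ka fj za)) !(mulr0, oppr0, addr0).
by rewrite Sa_ka // mulr0 addr0.
Qed.

Lemma ricci_ak y z : y \in a -> z \in k -> ricci y z = 0.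
Proof.
move=> ya zk; rewrite /ricci.
have -> : \sum_i Q (curv (e i) y z) (e i) = (2^-1 * (2^-1 - c)) * Sa y z.
  rewrite mulr_sumr; apply: eq_bigr => i _; have ei := ea i.
  rewrite (curv_diag_a _ _ ei) (conn_ak ei zk) connZr (conn_aa ya (br_ak ei zk)).
  rewrite -[X in conn X z](pa_pk ⟦e i, y⟧).
  rewrite connDl (conn_ak (pa_mem _) zk) (conn_kk (pk_mem _) zk).
  rewrite !(ipZl ip, ipDl ip) !(skewl (e i) y) !(skewr (e i) z).
  rewrite (Qka (pk_mem _) (br_ak ei zk)) (ip_sym ip (pa _)) (Qpa _ (br_ak ei zk)).
  by rewrite (ip_sym ip ⟦e i, z⟧); field.
have -> : \sum_j Q (curv (f j) y z) (f j) = 0.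
  rewrite big1 // => j _; have fj := fk j.
  rewrite (curv_diag_k _ _ fj) (conn_kk fj zk) connZr (conn_ak ya (kk fj zk)).
  rewrite (conn_ak (br_ka fj ya) zk) !(ipZl ip) (skewl (f j) y) (skewr (f j) z).
  by rewrite (Qka (kk fj zk) (br_ka fj ya)) (Qak (br_ka fj ya) (kk fj zk)) !(mulr0, oppr0, addr0).
by rewrite Sa_ak // mulr0 addr0.
Qed.

Lemma ricci_aa y z : y \in a -> z \in a ->
  ricci y z = 4^-1 * Sa y z + (4^-1 + c) * Sk y z.
Proof.
move=> ya za; rewrite /ricci.
have -> : \sum_i Q (curv (e i) y z) (e i) =
    4^-1 * Sa y z + (3 / 2 * c) * \sum_i Q (pk ⟦e i, z⟧) ⟦e i, y⟧.
  rewrite !mulr_sumr -big_split; apply: eq_bigr => i _ /=; have ei := ea i.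
  rewrite (curv_diag_a _ _ ei) (conn_aa ei za) connZr -[X in conn y X](pa_pk ⟦e i, z⟧).
  rewrite connDr (conn_aa ya (pa_mem _)) (conn_ak ya (pk_mem _)).
  rewrite -[X in conn X z](pa_pk ⟦e i, y⟧).
  rewrite connDl (conn_aa (pa_mem _) za) (conn_ka (pk_mem _) za).
  rewrite !(ipZl ip, ipDl ip) !(skewl (e i) y) !(skewr (e i) z).
  have E1 : Q (pa ⟦e i, y⟧) ⟦e i, z⟧ = Q (pa ⟦e i, z⟧) ⟦e i, y⟧.
    by rewrite -(Qpa _ (pa_mem ⟦e i, z⟧)) -(Qpa _ (pa_mem ⟦e i, y⟧)) (ip_sym ip).
  have E2 : Q (pk ⟦e i, y⟧) ⟦e i, z⟧ = Q (pk ⟦e i, z⟧) ⟦e i, y⟧.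
    by rewrite -(Qpk _ (pk_mem ⟦e i, z⟧)) -(Qpk _ (pk_mem ⟦e i, y⟧)) (ip_sym ip).
  have E3 : Q ⟦e i, y⟧ ⟦e i, z⟧ = Q (pa ⟦e i, z⟧) ⟦e i, y⟧ + Q (pk ⟦e i, z⟧) ⟦e i, y⟧.
    by rewrite -(ipDl ip) pa_pk (ip_sym ip).
  by rewrite E1 E2 E3; field.
have -> : \sum_j Q (curv (f j) y z) (f j) = (4^-1 - 2^-1 * c) * Sk y z.
  rewrite mulr_sumr; apply: eq_bigr => j _; have fj := fk j.
  rewrite (curv_diag_k _ _ fj) (conn_ka fj za) connZr (conn_aa ya (br_ka fj za)).
  rewrite (conn_aa (br_ka fj ya) za) !(ipZl ip) (skewl (f j) y) (skewr (f j) z).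
  by rewrite (ip_sym ip ⟦f j, z⟧); field.
by rewrite sum_pk // (Sk_sym z y); field.
Qed.

Lemma ricciDl y y' z : ricci (y + y') z = ricci y z + ricci y' z.
Proof.
rewrite /ricci addrACA -!big_split /=.
by congr (_ + _); apply: eq_bigr => i _; rewrite curvDm (ipDl ip).
Qed.

Lemma ricciDr y z z' : ricci y (z + z') = ricci y z + ricci y z'.
Proof.
rewrite /ricci addrACA -!big_split /=.
by congr (_ + _); apply: eq_bigr => i _; rewrite curvDr (ipDl ip).
Qed.

Lemma ricciE (zeta : R) :
  (forall y z, y \in a -> z \in a -> Sk y z = zeta * Q y z) ->
  forall y z, ricci y z = (4^-1 + c * zeta) * Q (pa y) (pa z) +
    ((2^-1 - c) ^+ 2 * (1 - kappa) + 4^-1 * kappa) * Q (pk y) (pk z).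
Proof.
move=> Ska y z; rewrite -{1}(pa_pk y) -{1}(pa_pk z).
have ya := pa_mem y; have yk := pk_mem y; have za := pa_mem z; have zk := pk_mem z.
rewrite ricciDl !ricciDr (ricci_aa ya za) (ricci_kk yk zk) (ricci_ka yk za).
rewrite (ricci_ak ya zk) addr0 add0r.
have SaE u v : Sa u v = Q u v - Sk u v by rewrite -SaSk addrK.
rewrite !SaE (Sk_kk yk zk) (Ska _ _ ya za); ring.
Qed.

End curvature.
End bases.
End decomposition.

(** * The scalar equations and the main result *)

(** The equations Ric = c T on [a] and on [k], for the metric with
    [t = alpha1 / alpha]. *)
Section scalar_equations.
Context {R : realType}.
Variables (zeta kappa Ta T1 : R).
Hypotheses (zeta_ge0 : 0 <= zeta) (kappa_ge0 : 0 <= kappa) (kappa_lt1 : kappa < 1).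
Hypotheses (Ta_gt0 : 0 < Ta) (T1_gt0 : 0 < T1).

Definition ricci_eqs (t c : R) : Prop :=
  4^-1 + (1 - t) / 2 * zeta = c * Ta /\
  (2^-1 - (1 - t) / 2) ^+ 2 * (1 - kappa) + 4^-1 * kappa = c * T1.

(** Elimination of [c]. *)
Lemma ricci_eqs_elim t c : ricci_eqs t c ->
  Ta * (1 - kappa) * t ^+ 2 + 2 * zeta * T1 * t = (2 * zeta + 1) * T1 - Ta * kappa.
Proof.
move=> [E1 E2].
have H1 : c * Ta * T1 = (4^-1 + (1 - t) / 2 * zeta) * T1 by rewrite E1.
have H2 : c * Ta * T1 = ((2^-1 - (1 - t) / 2) ^+ 2 * (1 - kappa) + 4^-1 * kappa) * Ta.
  by rewrite E2 mulrAC.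
have H : (4^-1 + (1 - t) / 2 * zeta) * T1 =
   ((2^-1 - (1 - t) / 2) ^+ 2 * (1 - kappa) + 4^-1 * kappa) * Ta by rewrite -H1 H2.
have {}H := congr1 (fun x => 4 * x) H.
have L : 4 * ((4^-1 + (1 - t) / 2 * zeta) * T1) = (1 + 2 * zeta * (1 - t)) * T1 by field.
have M : 4 * (((2^-1 - (1 - t) / 2) ^+ 2 * (1 - kappa) + 4^-1 * kappa) * Ta) =
  Ta * (1 - kappa) * t ^+ 2 + Ta * kappa by field.
move: H; rewrite L M => H; rewrite -(addrK (Ta * kappa) (Ta * (1 - kappa) * t ^+ 2)) -H; ring.
Qed.

(** The quadratic equation for [t] has a positive root exactly when its right-hand
    side is positive; then [c] is positive by the second equation. *)
Lemma ricci_eqs_exists :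
  (exists t c, [/\ 0 < t, 0 < c & ricci_eqs t c]) <-> Ta * kappa < (2 * zeta + 1) * T1.
Proof.
have p0 : 0 < Ta * (1 - kappa) by rewrite mulr_gt0 // subr_gt0.
have q0 : 0 <= 2 * zeta * T1 by rewrite !mulr_ge0 // ltW.
split=> [[t [c [t0 _ /ricci_eqs_elim E]]]|lt].
  rewrite -subr_gt0 -E; apply: ltr_pwDl; first exact: mulr_gt0 p0 (exprn_gt0 _ t0).
  exact: mulr_ge0 q0 (ltW t0).
set p := Ta * (1 - kappa) in p0; set q := 2 * zeta * T1 in q0.
pose r := (2 * zeta + 1) * T1 - Ta * kappa; have r0 : 0 < r by rewrite subr_gt0.
have pr0 : 0 < 4 * p * r by exact: mulr_gt0 (mulr_gt0 (ltr0Sn R 3) p0) r0.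
pose s := Num.sqrt (q ^+ 2 + 4 * p * r).
have s2 : s ^+ 2 = q ^+ 2 + 4 * p * r.
  by rewrite sqr_sqrtr // addr_ge0 ?sqr_ge0 // ltW.
have qs : q < s.
  by rewrite -(@ltr_pXn2r _ 2) ?nnegrE ?sqrtr_ge0 // s2 ltrDl.
(* the positive root of [p t^2 + q t = r] *)
pose t := (s - q) / (2 * p).
have t0 : 0 < t by rewrite divr_gt0 ?subr_gt0 // mulr_gt0.
have tE : p * t ^+ 2 + q * t = r.
  have -> : p * t ^+ 2 + q * t = (s ^+ 2 - q ^+ 2) / (4 * p).
    by rewrite /t; field; rewrite gt_eqF.
  by rewrite s2; field; rewrite gt_eqF.
pose c := ((2^-1 - (1 - t) / 2) ^+ 2 * (1 - kappa) + 4^-1 * kappa) / T1.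
exists t, c; split=> //.
  rewrite divr_gt0 // ltr_pwDl ?mulr_ge0 ?invr_ge0 // mulr_gt0 ?subr_gt0 //.
  have -> : 2^-1 - (1 - t) / 2 = t / 2 by field.
  by rewrite exprn_gt0 // divr_gt0.
split; last by rewrite /c divfK // gt_eqF.
have zE : (1 + 2 * zeta * (1 - t)) * T1 = p * t ^+ 2 + Ta * kappa.
  have -> : p * t ^+ 2 = r - q * t by rewrite -tE addrK.
  by rewrite /r /q; ring.
have -> : 4^-1 + (1 - t) / 2 * zeta = 4^-1 * ((1 + 2 * zeta * (1 - t)) * T1) / T1.
  by field; rewrite gt_eqF.
by rewrite zE /c /p; field; rewrite gt_eqF.
Qed.

Lemma ricci_eqs_unique t c t' c' : 0 < t -> 0 < t' ->
  ricci_eqs t c -> ricci_eqs t' c' -> t = t'.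
Proof.
move=> t0 t'0 /ricci_eqs_elim E /ricci_eqs_elim E'.
have p0 : 0 < Ta * (1 - kappa) by rewrite mulr_gt0 // subr_gt0.
have q0 : 0 <= 2 * zeta * T1 by rewrite !mulr_ge0 // ltW.
apply/eqP; rewrite -subr_eq0.
have : (t - t') * (Ta * (1 - kappa) * (t + t') + 2 * zeta * T1) = 0.
  transitivity ((Ta * (1 - kappa) * t ^+ 2 + 2 * zeta * T1 * t) -
                (Ta * (1 - kappa) * t' ^+ 2 + 2 * zeta * T1 * t')); first by ring.
  by rewrite E E' subrr.
move/eqP; rewrite mulf_eq0 => /orP[//|]; rewrite gt_eqF //.
by rewrite ltr_pwDl // mulr_gt0 // addr_gt0.
Qed.

End scalar_equations.

#[local] Opaque bracket Ad.

Section compact_simple.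
Context {R : realType} {G : lieGroupType R}.
Local Notation lg := (lie_algebra R G).

Lemma bracket_lie : lie_bracket (fun X Y : lg => bracket X Y).
Proof.
split; [exact: bracket_linearl|exact: bracketC|exact: jacobi].
Qed.

(** The adjoint action of a compact group preserves an inner product. *)
Lemma Ad_inner_product : compact [set: G] ->
  exists2 p : lg -> lg -> R, inner_product p &
    forall h X Y, p (Ad h X) (Ad h Y) = p X Y.
Proof.
move=> Gc; pose A (h : G) : 'M[R]_(@lie_dim R G) := \matrix_i (Ad h (delta_mx 0 i) : lg).
have AE h X : Ad h X = X *m A h.
  have [g gE] := to_linear (Ad_linear h); rewrite mulmx_sum_row.
  transitivity (g (\sum_i X 0 i *: delta_mx 0 i)); first by rewrite -row_sum_delta gE.
  by rewrite linear_sum; apply: eq_bigr => i _; rewrite linearZ /= rowK gE.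
have ext (M N : 'M[R]_(@lie_dim R G)) : (forall X : lg, X *m M = X *m N) -> M = N.
  by move=> MN; apply/row_matrixP => i; rewrite !rowE.
have [b Ab] : exists b, forall h i j, `|A h i j| <= b.
  have [C HC] := choice (fun i => Ad_bounded (delta_mx 0 i) Gc).
  exists (\sum_i `|C i|) => h i j; rewrite mxE; apply: le_trans (HC i h j) _.
  by rewrite (bigD1 i) //= ler_wpDr ?ler_norm // sumr_ge0.
have [|||P [Ps Pp PA]] := @invariant_form_exists _ _ _ A _ _ _ b Ab.
- by exists 1%g; apply: ext => X; rewrite -AE Ad1 mulmx1.
- by move=> g h; exists (h * g)%g; apply: ext => X; rewrite mulmxA -!AE AdM.
- by move=> g; exists (g^-1)%g; apply: ext => X; rewrite mulmxA -!AE AdKV mulmx1.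
exists (fun X Y => (X *m P *m Y^T) 0 0); first split.
- by move=> Y c X X'; rewrite !mulmxDl -!scalemxAl !mxE.
- move=> X Y; transitivity (((X *m P *m Y^T)^T) 0 0); first by rewrite [RHS]mxE.
  by rewrite !trmx_mul trmxK Ps mulmxA.
- exact: Pp.
move=> h X Y; by rewrite !AE trmx_mul -{2}(PA h) !mulmxA.
Qed.

(** The Koszul formula determines [nabla g X Y] when [g] is nondegenerate. *)
Lemma nablaE (g : lg -> lg -> R) (X Y Z : lg) :
  (forall u v : lg, (forall w, g u w = g v w) -> u = v) ->
  (forall w, 2 * g Z w = g (bracket X Y) w - g (bracket Y w) X + g (bracket w X) Y) ->
  nabla g X Y = Z.
Proof.
move=> ginj gZ; rewrite /nabla; set S := [set Z | _].
have : S (get S) by apply: getPex; exists Z; exact: gZ.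
move=> SZ; apply: ginj => w.
have two0 : 2 != 0 :> R by rewrite pnatr_eq0.
by apply: (mulfI two0); rewrite gZ; exact: SZ.
Qed.

End compact_simple.

Theorem proposition4p1 (R : realType) (G : lieGroupType R) (K : set G)
    (k a : {vspace lie_algebra R G}) (kappa1 Ta T1 : R)
    (G_compact : compact [set: G])
    (G_simple : simple_lie (fullv : {vspace lie_algebra R G}))
    (K_subgroup : compact_subgroup K)
    (K_nontrivial : K <> [set 1%g])
    (K_proper : K <> [set: G])
    (k_def : is_lie_algebra_of K k)
    (k_simple : simple_lie k)
    (a_def : is_orthogonal_complement k a)
    (a_irreducible : Ad_irreducible K a)
    (kappa1_def : forall X Y : lie_algebra R G, X \in k -> Y \in k ->
       killing k X Y = - kappa1 * Q X Y)
    (Ta_gt0 : 0 < Ta) (T1_gt0 : 0 < T1) :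
  let n : R := (\dim a)%:R in
  let d1 : R := (\dim k)%:R in
  let T := split_form a k Ta T1 in
  let solution (g : lie_form G) (c : R) :=
    [/\ M_K a k g, 0 < c & forall X Y : lie_algebra R G, Ric g X Y = c * T X Y] in
  ((exists g c, solution g c) <->
     n * Ta * kappa1 < (2 * d1 * (1 - kappa1) + n) * T1) /\
  (forall g g' c c', solution g c -> solution g' c' ->
     exists2 l : R, 0 < l & forall X Y : lie_algebra R G, g' X Y = l * g X Y).
Proof.
set lg := lie_algebra R G in k a k_def k_simple a_def a_irreducible kappa1_def *.
move=> n d1 T solution.
pose br := fun X Y : lg => bracket X Y.
have lb : lie_bracket br := bracket_lie.
have g_ideal (W : {vspace lg}) : (forall x y, y \in W -> br x y \in W) ->
    W = 0%VS \/ W = fullv.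
  move=> Wi; apply: G_simple.2; first exact: subvf.
  by move=> X Y _; exact: Wi.
have g_nonab : exists x y, br x y != 0.
  by have [X [Y [_ _ XY]]] := G_simple.1; exists X, Y.
(* [p] is an auxiliary inner product, which shows that [Q] is positive definite *)
have [p ip p_Ad] := Ad_inner_product G_compact.
have p_ad X Y Z : p (br X Y) Z + p Y (br X Z) = 0.
  apply: ad_invariant p_Ad X Y Z; first exact: ip_linear ip.
  by move=> X c Y Z; rewrite (ipDr ip) (ipZr ip).
pose q (X Y : lg) := Q X Y.
have ipq : inner_product q := kform_ip lb ip p_ad (simple_center0 lb g_nonab g_ideal).
have inv_q X Y Z : q (br X Y) Z + q Y (br X Z) = 0 := kform_inv lb ip p_ad X Y Z.
have q_Ad h X Y : q (Ad h X) (Ad h Y) = q X Y.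
  apply: (kform_aut lb ip p_ad (Ad_linear h) (AdKV h)); first exact: Ad_bracket.
  exact: p_Ad.
have q_kform X Y : kform br X Y = q X Y by [].
have kk X Y : X \in k -> Y \in k -> br X Y \in k by exact: (bracket_subalgebra K_subgroup k_def).
have aE X : X \in a <-> forall Y, Y \in k -> q X Y = 0 := a_def X.
have [J [f of_]] := onb_exists ipq k; have [I [e oe]] := onb_exists ipq a.
have a0 : a != 0%VS by apply/eqP; exact: a_irreducible.1.
have k0 : k != 0%VS.
  apply/eqP => k0; have [X [Y [Xk _]]] := k_simple.1.
  by move: Xk; rewrite k0 memv0 => /eqP ->; rewrite [bracket _ _](br0l lb) eqxx.
have kappaE X Y : X \in k -> Y \in k -> kform_on br k X Y = kappa1 * q X Y.
  by move=> Xk Yk; rewrite -[LHS]/(- killing k X Y) kappa1_def // mulNr opprK.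
pose H := {h : G | K h}.
have [zeta zE] : exists zeta, forall y z, y \in a -> z \in a -> Sk br q f y z = zeta * q y z.
  have [_ _ KM KV] := K_subgroup.
  apply: (casimir_scalar lb ipq aE oe of_ (act := fun h : H => Ad (sval h))).
  - by move=> h; exact: Ad_linear.
  - move=> [h Kh]; exists (exist _ (h^-1)%g (KV _ Kh)) => /=.
    by split=> X; [exact: AdVK|exact: AdKV].
  - by move=> h X Y; exact: Ad_bracket.
  - by move=> h X Y; exact: q_Ad.
  - by move=> [h Kh] X Xk; exact: (Ad_subalgebra K_subgroup k_def Kh Xk).
  - exact: a_irreducible.1.
  - move=> W Wa WH; apply: a_irreducible.2 => // h X Kh XW.
    exact: (WH (exist _ h Kh)).
have ztr := casimir_trace lb ipq inv_q q_kform kk aE oe of_ kappaE zE.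
have kge0 := kappa_ge0 lb ipq inv_q kk of_ kappaE k0.
have klt1 := kappa_lt1 lb ipq inv_q q_kform kk aE oe of_ kappaE k0 g_ideal a0.
have n0 : 0 < n by rewrite ltr0n lt0n dimv_eq0.
have zE' : zeta = d1 * (1 - kappa1) / n by rewrite -ztr mulfK // gt_eqF.
have z0 : 0 <= zeta.
  by rewrite zE' divr_ge0 ?mulr_ge0 ?ler0n // ?subr_ge0 ltW.
(* the Ricci tensor of a metric of [M_K] is diagonal as well *)
have RicE al al1 X Y : 0 < al -> 0 < al1 -> Ric (split_form a k al al1) X Y =
    split_form a k (4^-1 + (1 - al1 / al) / 2 * zeta)
      ((2^-1 - (1 - al1 / al) / 2) ^+ 2 * (1 - kappa1) + 4^-1 * kappa1) X Y.
  move=> al0 al10; set c := (1 - al1 / al) / 2.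
  have nE U V : nabla (split_form a k al al1) U V = conn br k a c U V.
    apply: nablaE => [u v uv|w].
      exact: (gform_inj ipq aE al0 al10 uv).
    exact: (koszul lb ipq inv_q kk aE U V w al0 (erefl c)).
  have cE U V W : curvature (split_form a k al al1) U V W = curv br k a c U V W.
    by rewrite /curvature /curv !nE.
  transitivity (ricci br q k a e f c X Y).
    rewrite /Ric /trace_on.
    under eq_bigr => i _ do rewrite cE.
    rewrite (trace_onb ipq (onb_full ipq aE oe of_) (f := fun U => curv br k a c U X Y)).
    - by rewrite big_sumType.
    - exact: curv_linear.
    - by move=> u _; exact: memvf.
  exact: (ricciE lb ipq inv_q q_kform kk aE oe of_ kappaE c zE).
have va := memv_pick a; have vk := memv_pick k.
have qa : 0 < q (vpick a) (vpick a) by apply: (ip_pos ipq); rewrite vpick0.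
have qk : 0 < q (vpick k) (vpick k) by apply: (ip_pos ipq); rewrite vpick0.
have sfa al al1 : split_form a k al al1 (vpick a) (vpick a) = al * q (vpick a) (vpick a).
  rewrite -[LHS]/(gform q k a al al1 _ _) (gformE ipq aE) (pa_id ipq aE va).
  by rewrite (pk0 ipq aE va) (ip0l ipq) mulr0 addr0.
have sfk al al1 : split_form a k al al1 (vpick k) (vpick k) = al1 * q (vpick k) (vpick k).
  rewrite -[LHS]/(gform q k a al al1 _ _) (gformE ipq aE) (pk_id ipq aE vk).
  by rewrite (pa0 ipq aE vk) (ip0l ipq) mulr0 add0r.
have sfZ c al al1 X Y : c * split_form a k al al1 X Y = split_form a k (c * al) (c * al1) X Y.
  have distr (x y u v : R) : c * (x * u + y * v) = (c * x) * u + (c * y) * v by ring.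
  exact: distr.
(* comparing values at nonzero vectors of [a] and of [k] *)
have solE al al1 c : 0 < al -> 0 < al1 ->
    (forall X Y, Ric (split_form a k al al1) X Y = c * T X Y) <->
    ricci_eqs zeta kappa1 Ta T1 (al1 / al) c.
  move=> al0 al10; split=> [E|[E1 E2] X Y]; last by rewrite RicE // E1 E2 sfZ.
  have E' X Y := etrans (esym (RicE al al1 X Y al0 al10)) (etrans (E X Y) (sfZ _ _ _ X Y)).
  split.
  - have := E' (vpick a) (vpick a); rewrite !sfa; exact: (mulIf (negbT (gt_eqF qa))).
  - have := E' (vpick k) (vpick k); rewrite !sfk; exact: (mulIf (negbT (gt_eqF qk))).
split.
  have -> : (n * Ta * kappa1 < (2 * d1 * (1 - kappa1) + n) * T1) =
      (Ta * kappa1 < (2 * zeta + 1) * T1).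
    rewrite -[RHS](ltr_pM2l n0) mulrA; congr (_ < _).
    transitivity ((2 * (zeta * n) + n) * T1); last by ring.
    by rewrite ztr !mulrA.
  apply: iff_trans (ricci_eqs_exists z0 kge0 klt1 Ta_gt0 T1_gt0); split.
  - move=> [g [c [[al [al1 [al0 al10 ->]]] c0 E]]].
    by exists (al1 / al), c; split; [exact: divr_gt0|exact: c0|exact/(solE _ _ _ al0 al10)].
  - move=> [t [c [t0 c0 E]]]; exists (split_form a k 1 t), c; split.
    + by exists 1, t.
    + exact: c0.
    + by apply/solE => //; rewrite divr1.
move=> g g' c c' [[al [al1 [al0 al10 ->]]] _ E] [[be [be1 [be0 be10 ->]]] _ E'].
have {}E := (solE _ _ _ al0 al10).1 E; have {}E' := (solE _ _ _ be0 be10).1 E'.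
have tE := ricci_eqs_unique z0 klt1 Ta_gt0 T1_gt0 (divr_gt0 al10 al0) (divr_gt0 be10 be0) E E'.
exists (be / al) => [|X Y]; first exact: divr_gt0.
rewrite sfZ divfK ?gt_eqF //; congr (split_form _ _ _ _ _ _).
by rewrite mulrAC -mulrA tE mulrC divfK // gt_eqF.
Qed.
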